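(* Let $k\geq 3$ be a fixed integer and let $p=p(n)$ satisfy $\frac{\log^{4k}n}{n^{k-1}}\leq p\leq \frac{\log^{20k}n}{n^{k-1}}$. Then there is a function $\varepsilon(n)\to 0$ such that, with probability tending to $1$ as $n\to\infty$, the random $k$-partite hypergraph $H^k_{n\times k,p}$ contains at least $(1-\varepsilon(n))n^{k-1}p$ pairwise edge-disjoint perfect matchings.
   Context: $H^k_{n\times k,p}$ denotes the random $k$-partite $k$-uniform hypergraph with disjoint vertex parts $V_1,\dots,V_k$, each of size $n$, in which each $k$-tuple $e\in V_1\times V_2\times\cdots\times V_k$ is an edge independently with probability $p$. A perfect matching is a set of pairwise vertex-disjoint edges covering all $kn$ vertices. *)

(* Defs.v *)
From HB Require Import structures.
From mathcomp Require Import all_boot all_order all_algebra.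
From mathcomp Require Import all_classical all_reals all_analysis.

Set Implicit Arguments.
Unset Strict Implicit.
Unset Printing Implicit Defensive.

Import Order.TTheory GRing.Theory Num.Theory.

Local Open Scope ring_scope.

Section PartiteHypergraph.
Variables k n : nat.

(* (i, j) is the j-th vertex of the part V_i. *)
Definition vertex : finType := ('I_k * 'I_n)%type.

(* A k-tuple of V_1 x ... x V_k: e i is the index of its vertex in V_i. *)
Definition edge : finType := {ffun 'I_k -> 'I_n}.

Definition edge_vertices (e : edge) : {set vertex} :=
  [set (i, e i) | i : 'I_k].

Definition hypergraph : finType := {set edge}.

Definition perfect_matching (H : hypergraph) (M : {set edge}) : bool :=
  [&& M \subset H,
      [forall e in M, forall f in M,
         (e != f) ==> [disjoint edge_vertices e & edge_vertices f]] &
      [forall v : vertex, exists e in M, v \in edge_vertices e]].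

Definition edge_disjoint_perfect_matchings
    (H : hypergraph) (F : {set {set edge}}) : bool :=
  [forall M in F, perfect_matching H M] &&
  [forall M1 in F, forall M2 in F, (M1 != M2) ==> [disjoint M1 & M2]].

Variable R : realType.

(* The mass that the random hypergraph with independent edges of
   probability p gives to H. *)
Definition hypergraph_mass (p : R) (H : hypergraph) : R :=
  \prod_(e : edge) (if e \in H then p else 1 - p).

Definition hypergraph_prob (p : R) (A : pred hypergraph) : R :=
  \sum_(H : hypergraph | A H) hypergraph_mass p H.

Lemma hypergraph_probT (p : R) : hypergraph_prob p xpredT = 1.
Proof.
rewrite /hypergraph_prob /hypergraph_mass.
rewrite -(bigA_distr _ _ (fun=> p) (fun=> 1 - p)).
by rewrite big1 // => e _; exact: subrKC.
Qed.

Lemma hypergraph_prob_ge0 (p : R) (A : pred hypergraph) :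
  0 <= p <= 1 -> 0 <= hypergraph_prob p A.
Proof.
case/andP=> p0 p1; apply: sumr_ge0 => H _; apply: prodr_ge0 => e _.
by case: ifP => // _; rewrite subr_ge0.
Qed.

Lemma hypergraph_prob_edges (p : R) (S : {set edge}) :
  hypergraph_prob p (fun H => S \subset H) = p ^+ #|S|.
Proof.
pose G (e : edge) := if e \in S then 0 else 1 - p.
have -> : p ^+ #|S| = \prod_(e : edge) (p + G e).
  rewrite -prodr_const big_mkcond; apply: eq_bigr => e _.
  by rewrite /G; case: ifP => _; rewrite ?addr0 // subrKC.
rewrite bigA_distr /hypergraph_prob big_mkcond; apply: eq_bigr => H _ /=.
case: ifPn => [/fintype.subsetP sSH | /fintype.subsetPn[e eS eH]].
  apply: eq_bigr => e _; case: ifPn => // eH; rewrite /G.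
  by case: ifP => // /sSH; rewrite (negPf eH).
by rewrite (bigD1 e) //= (negPf eH) /G eS mul0r.
Qed.

End PartiteHypergraph.

Arguments hypergraph_prob k n {R} p A.

(* Main.v *)
Require Import Defs.
From HB Require Import structures.
From mathcomp Require Import all_boot all_order all_algebra all_fingroup.
From mathcomp Require Import all_classical all_reals all_analysis.
From mathcomp Require Import fintype finset ring lra zify.
Import Order.TTheory GRing.Theory Num.Theory.
Import numFieldNormedType.Exports.
Set Implicit Arguments.
Unset Strict Implicit.
Unset Printing Implicit Defensive.
Local Open Scope ring_scope.

(** A single perfect matching can be found by an adaptive procedure that wastes
almost no randomness. Scan all [k]-tuples and query, with probability
[q = polylog n / n^(k-1)], only those disjoint from the matching built so far;
every successful query is accepted, so the expected number of queries, weighted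
by [q], is at most [n]. Once all but [m = n / log^3 n] vertices of each part are
covered, expose all tuples on the uncovered vertices with probability
[polylog n / m^(k-1)]; a perfect matching of them appears by the spread lemma
(minimal fragments, Park-Pham), at total cost [o(n)].

Translating everything by a uniform element of [(Z/n)^k] makes the expected
cost of each tuple [(1 + o(1)) / n^(k-1)] and each tuple used with probability
at most [1 / n^(k-1)]. Running [N = (1 - o(1)) n^(k-1) p] rounds with fresh
randomness, the total cost of every tuple stays below [p] by a Chernoff bound,
so all rounds can be read off one sample of the hypergraph; since [k >= 3], two
rounds rarely share an edge. The Chernoff bound, the coupling and the
disjointness are handled together by one potential function, updated round by
round. *)

(** * Product measures on subsets and the spread lemma *)

Section Expect.
Variables (R : realFieldType) (E : finType).
Implicit Types (u v : E -> R) (F G : {set E} -> R) (e : E) (H T : {set E}).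

(** Probabilities depend on the edge because later arguments spend a separate budget on each
    edge. *)
Definition mass u H : R := \prod_e (if e \in H then u e else 1 - u e).

Definition expect u F : R := \sum_H mass u H * F H.

Definition prob_fun u := forall e, 0 <= u e <= 1.

Definition increasing F := forall H T, H \subset T -> F H <= F T.

Lemma eq_expect u v F G : u =1 v -> F =1 G -> expect u F = expect v G.
Proof.
move=> uv FG; apply: eq_bigr => H _; rewrite FG; congr (_ * _).
by apply: eq_bigr => e _; rewrite uv.
Qed.

Lemma expect_cst u c : expect u (fun=> c) = c.
Proof.
rewrite /expect -mulr_suml /mass -(bigA_distr _ _ u (fun e => 1 - u e)).
by rewrite big1 ?mul1r // => e _ /=; rewrite subrKC.
Qed.

Lemma expectD u F G : expect u (fun H => F H + G H) = expect u F + expect u G.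
Proof. by rewrite -big_split; apply: eq_bigr => H _; rewrite mulrDr. Qed.

Lemma expectZ u c F : expect u (fun H => c * F H) = c * expect u F.
Proof. by rewrite mulr_sumr; apply: eq_bigr => H _; rewrite mulrCA. Qed.

Lemma expect_sum u (I : finType) (P : pred I) (F : I -> {set E} -> R) :
  expect u (fun H => \sum_(i | P i) F i H) = \sum_(i | P i) expect u (F i).
Proof.
rewrite exchange_big; apply: eq_bigr => H _; exact: mulr_sumr.
Qed.

Lemma mass_ge0 u H : prob_fun u -> 0 <= mass u H.
Proof.
move=> u01; apply: prodr_ge0 => e _; have /andP[u0 u1] := u01 e.
by case: ifP => // _; rewrite subr_ge0.
Qed.

Lemma ler_expect u F G :
  prob_fun u -> (forall H, F H <= G H) -> expect u F <= expect u G.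
Proof. by move=> u01 FG; apply: ler_sum => H _; rewrite ler_wpM2l ?mass_ge0. Qed.

Lemma expect_ge0 u F : prob_fun u -> (forall H, 0 <= F H) -> 0 <= expect u F.
Proof. by move=> u01 F0; apply: sumr_ge0 => H _; rewrite mulr_ge0 ?mass_ge0. Qed.

(** Each set without [e] is paired with the set obtained by adding [e]; the other coordinates then
    contribute a common factor. *)
Lemma expect_split u e F : expect u F =
  \sum_(H : {set E} | e \notin H)
     (\prod_(x | x != e) (if x \in H then u x else 1 - u x)) *
     ((1 - u e) * F H + u e * F (e |: H)).
Proof.
rewrite /expect (bigID (fun H : {set E} => e \notin H)) /=.
rewrite [X in _ + X](reindex_onto (fun H => e |: H) (fun H => H :\ e)) /=; last first.
  by move=> H; rewrite negbK => eH; rewrite setD1K.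
rewrite [X in _ + X](eq_bigl (fun H : {set E} => e \notin H)); last first.
  move=> H; rewrite negbK setU11 /=; apply/eqP/idP => [<-|eH].
    by rewrite setD11.
  by rewrite setU1K.
rewrite -big_split /=; apply: eq_bigr => H eH.
have m1 : mass u H =
    (1 - u e) * \prod_(x | x != e) (if x \in H then u x else 1 - u x).
  by rewrite /mass (bigD1 e) //= (negPf eH).
have m2 : mass u (e |: H) =
    u e * \prod_(x | x != e) (if x \in H then u x else 1 - u x).
  rewrite /mass (bigD1 e) //= setU11; congr (_ * _).
  by apply: eq_bigr => x xe; rewrite in_setU1 (negPf xe).
by rewrite m1 m2; ring.
Qed.

Let rest_ge0 u e H : prob_fun u ->
  0 <= \prod_(x | x != e) (if x \in H then u x else 1 - u x).
Proof.
move=> u01; apply: prodr_ge0 => x _; have /andP[u0 u1] := u01 x.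
by case: ifP => // _; rewrite subr_ge0.
Qed.

Lemma expect_peel u v e F : v e = 0 -> (forall x, x != e -> v x = u x) ->
  expect u F = expect v (fun H => (1 - u e) * F H + u e * F (e |: H)).
Proof.
move=> ve vu; rewrite (expect_split u e) (expect_split v e).
apply: eq_bigr => H _; rewrite ve mul0r addr0 subr0 mul1r; congr (_ * _).
by apply: eq_bigr => x xe; rewrite vu.
Qed.

Lemma expect0 u F : u =1 (fun=> 0) -> expect u F = F set0.
Proof.
move=> u0; rewrite /expect (bigD1 set0) //= big1 => [|H H0].
  by rewrite addr0 /mass big1 ?mul1r // => e _; rewrite inE u0 subr0.
have [e eH] := set0Pn _ H0.
by rewrite /mass (bigD1 e) //= eH u0 !mul0r.
Qed.

Definition spend u e q : E -> R := fun x => u x - q *+ (x == e).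

(* Querying [e] with probability [q] consumes [q] of its budget [u e]. *)
Lemma expect_query u e q F (u01 : prob_fun u) (Fi : increasing F)
    (qu : 0 <= q <= u e) :
  (1 - q) * expect (spend u e q) F +
  q * expect (spend u e q) (fun H => F (e |: H)) <= expect u F.
Proof.
set u' := spend u e q; have /andP[q0 {}qu] := qu.
rewrite !(expect_split _ e) !mulr_sumr -big_split /=; apply: ler_sum => H eH.
have -> : \prod_(x | x != e) (if x \in H then u' x else 1 - u' x) =
          \prod_(x | x != e) (if x \in H then u x else 1 - u x).
  by apply: eq_bigr => x xe; rewrite /u' /spend (negPf xe) subr0.
set c := \prod_(_ | _) _; have c0 : 0 <= c by exact: rest_ge0.
have FH : F H <= F (e |: H) by apply: Fi; exact: subsetUr.
have /andP[_ u1] := u01 e.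
rewrite setUA setUid /u' /spend eqxx mulr1n.
rewrite mulrCA [q * _]mulrCA -mulrDr ler_wpM2l //.
have : 0 <= q * (u e - q) * (F (e |: H) - F H).
  by rewrite !mulr_ge0 ?subr_ge0.
nra.
Qed.

(** Two-stage exposure: the union of independent samples of rates [v] and [u - v] contains each edge
    with probability at most [u]. Edges of the first sample are peeled off one at a time, each by
    [expect_query]. *)
Lemma expect_union u v F : prob_fun u -> increasing F ->
  (forall e, 0 <= v e <= u e) ->
  expect v (fun X => expect (fun e => u e - v e) (fun Y => F (X :|: Y)))
    <= expect u F.
Proof.
move=> u01 Fi.
(* The list [l] carries the support of [v], and the induction removes one edge from that support. *)
suff H (l : seq E) : forall v, (forall e, 0 <= v e <= u e) ->
    (forall e, e \notin l -> v e = 0) ->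
    expect v (fun X => expect (fun e => u e - v e) (fun Y => F (X :|: Y)))
    <= expect u F.
  by move=> vu; apply: (H (enum E)) => // e; rewrite mem_enum.
elim: l => [|e l IHl] {}v vu vl.
  rewrite expect0; last by move=> e; rewrite vl.
  by rewrite (@eq_expect _ u _ F) // => x; rewrite ?set0U // vl ?subr0.
pose v' x := if x == e then 0 else v x.
have v'u x : 0 <= v' x <= u x.
  rewrite /v'; case: ifP => _ //; rewrite lexx.
  by have /andP[] := vu x; exact: le_trans.
rewrite (@expect_peel _ v' e); last 2 first.
- by rewrite /v' eqxx.
- by move=> x xe; rewrite /v' (negPf xe).
have v'l x : x \notin l -> v' x = 0.
  by rewrite /v'; case: eqP => // /eqP xe xl; rewrite vl // inE (negPf xe).
apply: le_trans (IHl v' v'u v'l); apply: ler_expect => [x|X].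
  have /andP[? ?] := v'u x; have /andP[? ?] := u01 x; lra.
have Fi' : increasing (fun Y => F (X :|: Y)).
  by move=> A B AB; apply: Fi; exact: setUS.
have p' : prob_fun (fun x => u x - v' x).
  move=> x; have /andP[? ?] := v'u x; have /andP[? ?] := u01 x; lra.
have /(expect_query p' Fi') : 0 <= v e <= u e - v' e.
  by rewrite /v' eqxx subr0.
apply: le_trans; rewrite le_eqVlt; apply/orP; left; apply/eqP.
have eu x : u x - v x = u x - v' x - v e *+ (x == e).
  by rewrite /v'; case: eqP => [->|_]; rewrite ?subr0 ?mulr1n ?mulr0n ?subr0.
congr (_ * _ + _ * _); apply: eq_expect => //= Y.
by rewrite [in RHS]setUCA setUA.
Qed.

(** The sample contains [T] with probability at least [p ^+ #|T|], and given this event it is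
    distributed as [T :|: H]. *)
Lemma expect_plant u (p : R) T G : prob_fun u -> 0 <= p ->
  (forall e, e \in T -> p <= u e) -> (forall H, 0 <= G H) ->
  p ^+ #|T| * expect u (fun H => G (T :|: H)) <= expect u G.
Proof.
move=> u01 p0 + G0; rewrite cardE => pu.
have {pu} : forall e, e \in enum T -> p <= u e.
  by move=> e; rewrite mem_enum; exact: pu.
have -> : expect u (fun H => G (T :|: H)) =
          expect u (fun H => G ([set x in enum T] :|: H)).
  by rewrite set_enum.
elim: (enum T) G G0 => [|e l IHl] G G0 pu.
  rewrite mul1r [X in X <= _](@eq_expect _ u _ G) // => H.
  suff -> : [set x in [::]] = set0 :> {set E} by rewrite set0U.
  by apply/setP => x; rewrite !inE.
have pe : p <= u e by apply: pu; rewrite inE eqxx.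
have IH := IHl (fun H => G (e |: H)) (fun H => G0 _)
  (fun x xl => pu x (@mem_behead _ (e :: l) x xl)).
rewrite exprS -mulrA /=.
apply: le_trans (_ : p * expect u (fun H => G (e |: H)) <= _).
  rewrite ler_wpM2l //; apply: le_trans IH.
  rewrite ler_wpM2l ?exprn_ge0 // le_eqVlt; apply/orP; left; apply/eqP.
  by apply: eq_expect => // H; rewrite set_cons setUA.
rewrite !(expect_split u e) mulr_sumr; apply: ler_sum => H eH.
rewrite mulrCA ler_wpM2l ?rest_ge0 // setUA setUid.
have /andP[ue0 ue1] := u01 e.
have h1 : 0 <= (u e - p) * G (e |: H) by rewrite mulr_ge0 ?subr_ge0.
have h2 : 0 <= (1 - u e) * G H by rewrite mulr_ge0 ?subr_ge0.
lra.
Qed.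

End Expect.

(** * Spread families and minimal fragments *)

Section Spread.
Variables (R : realFieldType) (E I : finType).
Implicit Types (u : E -> R) (f : I -> {set E}) (D : {set I}) (W T : {set E}).

Definition misses f D W : R := (~~ [exists h in D, f h \subset W])%:R.

(** With [M = #|D|] this is the usual spread condition: a fraction at most [kappa ^- #|T|] of the
    members contains [T]. Keeping [M] separate lets the condition pass to subfamilies with the same
    [M]; indexing by [f] allows repeated sets, since fragments of different members may coincide. *)
Definition spread f D (M kappa : R) := forall T,
  #|[set h in D | T \subset f h]|%:R * kappa ^+ #|T| <= M.

Definition fragment f D W (h : I) : {set E} :=
  f [arg min_(h' < h | (h' \in D) && (f h' \subset W :|: f h))
       #|f h' :\: W|] :\: W.

Lemma fragmentP f D W h : h \in D -> exists2 h', h' \in D &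
  [/\ fragment f D W h = f h' :\: W, f h' \subset W :|: f h &
    forall h'', h'' \in D -> f h'' \subset W :|: f h ->
      (#|fragment f D W h| <= #|f h'' :\: W|)%N].
Proof.
move=> hD; rewrite /fragment; case: arg_minnP => [|h' /andP[h'D h'W] hmin].
  by rewrite hD subsetUr.
exists h' => //; split=> // h'' h''D h''W.
by apply: hmin; rewrite h''D.
Qed.

Lemma fragment_sub f D W h : h \in D -> fragment f D W h \subset f h.
Proof. by move=> /(fragmentP f W)[h' _ [-> h'W _]]; rewrite subDset. Qed.

(** A canonical choice that depends on [W] alone; [set0] is a dummy value for a [W] that contains no
    member. *)
Definition selected f D W : {set E} :=
  if [pick h in D | f h \subset W] is Some h then f h else set0.

(* Minimality makes the fragment recoverable from [W :|: fragment]: it is a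
   subset of any member of the family contained in that union. *)
Lemma fragment_selected f D W h : h \in D ->
  fragment f D W h \subset selected f D (fragment f D W h :|: W).
Proof.
move=> hD; set T := fragment f D W h; have [h' h'D [TE h'W Tmin]] := fragmentP f W hD.
rewrite /selected; case: pickP => [h'' /andP[h''D h''T]|/(_ h')]; last first.
  by rewrite h'D /= /T TE setUC -subDset subxx.
have sub1 : f h'' :\: W \subset T by rewrite subDset setUC.
have /Tmin : f h'' \subset W :|: f h.
  by apply: (subset_trans h''T); rewrite setUC setUS // fragment_sub.
move=> /(_ h''D) cardT.
have /eqP <- : f h'' :\: W == T by rewrite eqEcard sub1.
exact: subsetDl.
Qed.

(** Union bound over the possible fragments [T]. Spreadness gives at most [M * kappa ^- #|T|]
    members containing [T], and planting [T] in the sample costs a factor [p ^- #|T|]. By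
    [fragment_selected], [T] is then a subset of the selected member of the planted sample, which
    has at most [2 ^ s.*2.+1 <= 4 ^ s.+1] subsets; the total is [M * (4 / 20) ^+ s.+1]. *)
Lemma large_fragment u f D (M kappa p : R) (s : nat) :
  prob_fun u -> spread f D M kappa -> 0 < kappa -> 0 < p -> 20 <= p * kappa ->
  (forall h, h \in D -> (#|f h| <= s.*2.+1)%N) ->
  (forall h e, h \in D -> e \in f h -> p <= u e) ->
  expect u (fun W => #|[set h in D | (s < #|fragment f D W h|)%N]|%:R)
    <= M * 5^-1 ^+ s.+1.
Proof.
move=> u01 sp k0 p0 pk fs fu.
have M0 : 0 <= M by apply: le_trans (sp set0); rewrite mulr_ge0 // exprn_ge0 // ltW.
pose num T : R := #|[set h in D | T \subset f h]|%:R.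
have stepA W : #|[set h in D | (s < #|fragment f D W h|)%N]|%:R <=
   \sum_(T : {set E} | (s < #|T|)%N) num T * (T \subset selected f D (T :|: W))%:R.
  rewrite -sum1_card natr_sum.
  under [leRHS]eq_bigr => T sT.
    rewrite /num -sum1_card natr_sum mulr_suml big_mkcond /=.
    over.
  rewrite exchange_big /= big_mkcond /=; apply: ler_sum => h _.
  rewrite inE; case: (boolP (h \in D)) => [hD|hD]; last first.
    by apply: sumr_ge0 => T _; rewrite inE (negPf hD).
  case: (ltnP s _) => [sT|_]; last first.
    by apply: sumr_ge0 => T _; case: ifP => // _; rewrite mul1r.
  rewrite (bigD1 (fragment f D W h)) //= inE hD fragment_sub //=.
  rewrite fragment_selected // mulr1 lerDl.
  by apply: sumr_ge0 => T _; case: ifP => // _; rewrite mul1r.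
apply: le_trans (ler_expect u01 stepA) _.
rewrite expect_sum.
have stepB T : (s < #|T|)%N ->
    expect u (fun W => num T * (T \subset selected f D (T :|: W))%:R) <=
    M * 20^-1 ^+ s.+1 * expect u (fun Z => (T \subset selected f D Z)%:R).
  move=> sT; rewrite expectZ.
  set a := expect _ _; set b := expect _ _.
  have b0 : 0 <= b by apply: expect_ge0.
  have a0 : 0 <= a by apply: expect_ge0.
  have c0 : (0 : R) <= 20^-1 by rewrite invr_ge0.
  have [/eqP|/set0Pn[h]] := eqVneq [set h in D | T \subset f h] set0.
    rewrite -cards_eq0 /num => /eqP ->; rewrite mul0r.
    by rewrite !mulr_ge0 ?exprn_ge0.
  rewrite inE => /andP[hD Tf].
  have pab : p ^+ #|T| * a <= b.
    apply: (@expect_plant _ _ u p T (fun Z => (T \subset selected f D Z)%:R)) => //.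
      exact: ltW.
    by move=> e eT; apply: fu hD _; exact: (fintype.subsetP Tf).
  have pT : 0 < (p * kappa) ^+ #|T| by rewrite exprn_gt0 // mulr_gt0.
  have -> : num T * a = (num T * kappa ^+ #|T|) * (p ^+ #|T| * a) / (p * kappa) ^+ #|T|.
    have kT : kappa ^+ #|T| != 0 by rewrite gt_eqF ?exprn_gt0.
    have pT' : p ^+ #|T| != 0 by rewrite gt_eqF ?exprn_gt0.
    by rewrite exprMn; field; rewrite kT pT'.
  rewrite -mulrA [leRHS]mulrAC -[leRHS]mulrA.
  rewrite ler_pM //.
  - by rewrite mulr_ge0 // exprn_ge0 // ltW.
  - by rewrite divr_ge0 ?mulr_ge0 ?exprn_ge0 // ltW // mulr_gt0.
  - exact: sp.
  apply: ler_pM => //; first by rewrite mulr_ge0 // exprn_ge0 // ltW.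
    by rewrite invr_ge0 ltW.
  rewrite exprVn lef_pV2 ?posrE ?exprn_gt0 //; last by lra.
  apply: (@le_trans _ _ (20 ^+ #|T|)); last by rewrite lerXn2r ?nnegrE //; lra.
  by rewrite ler_eXn2l //; lra.
apply: le_trans (ler_sum _ stepB) _.
rewrite -mulr_sumr -mulrA ler_wpM2l //.
have -> : (5^-1 : R) ^+ s.+1 = 20^-1 ^+ s.+1 * 4 ^+ s.+1.
  by rewrite -exprMn; congr (_ ^+ _); field.
rewrite ler_wpM2l ?exprn_ge0 ?invr_ge0 // -expect_sum.
rewrite -[leRHS](expect_cst u); apply: ler_expect => // Z.
have selZ : (#|selected f D Z| <= s.*2.+1)%N.
  by rewrite /selected; case: pickP => [h /andP[/fs]|_] //; rewrite cards0.
rewrite -natr_sum -natrX ler_nat.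
apply: (@leq_trans (\sum_(T : {set E} | T \subset selected f D Z) 1)).
  rewrite big_mkcond [leqRHS]big_mkcond /=; apply: leq_sum => T _.
  by case: ifP => //; case: ifP.
rewrite sum1_card -cardsE.
have -> : [set T : {set E} | T \subset selected f D Z] = powerset (selected f D Z).
  by apply/setP => T; rewrite !inE.
rewrite card_powerset (@leq_trans (2 ^ s.*2.+1)) ?leq_exp2l //.
by rewrite -[4%N]/(2 ^ 2)%N -expnM leq_exp2l // mul2n doubleS.
Qed.

(** Each of the [L] stages exposes a fresh sample of rate [u], replaces members by their fragments
    and gives up those whose fragment exceeds half the current size bound. After [L] halvings the
    bound is zero, and an empty member is contained in every set. The losses [5^-1 ^+ s.+1] add up
    to at most a quarter. *)
Lemma spread_covers u f D (M kappa p : R) (L r : nat) :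
  prob_fun (fun e => u e *+ L) -> (forall e, 0 <= u e) ->
  spread f D M kappa -> 0 < kappa -> 0 < p -> 20 <= p * kappa -> (r < 2 ^ L)%N ->
  (forall h, h \in D -> (#|f h| <= r)%N) ->
  (forall h e, h \in D -> e \in f h -> p <= u e) ->
  #|D|%:R * expect (fun e => u e *+ L) (misses f D) <= M * ((1 - 5^-1 ^+ r) / 4).
Proof.
move=> u01 u0 sp k0 p0 pk.
have M0 : 0 <= M by apply: le_trans (sp set0); rewrite mulr_ge0 // exprn_ge0 // ltW.
elim: L r f D u01 sp => [|L IHL] r f D u01 sp rL fr fu.
  have {rL} r0 : r = 0%N by move: rL; rewrite expn0 ltnS leqn0 => /eqP.
  rewrite r0 expr0 subrr mul0r mulr0.
  have [->|/set0Pn[h hD]] := eqVneq D set0; first by rewrite cards0 mul0r.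
  rewrite (@eq_expect _ _ _ (fun=> 0) _ (fun=> 0)); first by rewrite expect_cst mulr0.
    by move=> e; rewrite mulr0n.
  move=> W; rewrite /misses; case: existsP => // -[]; exists h.
  by rewrite hD /=; have := fr h hD; rewrite r0 leqn0 cards_eq0 => /eqP ->; rewrite sub0set.
case: r rL fr => [|r'] rL fr.
  rewrite expr0 subrr mul0r mulr0.
  have [->|/set0Pn[h hD]] := eqVneq D set0; first by rewrite cards0 mul0r.
  rewrite (eq_expect (v := fun e => u e *+ L.+1) (G := fun=> 0)) //.
    by rewrite expect_cst mulr0.
  move=> W; rewrite /misses; case: existsP => // -[]; exists h.
  by rewrite hD /=; have := fr h hD; rewrite leqn0 cards_eq0 => /eqP ->; rewrite sub0set.
(* Half the size bound, rounded down: [r <= s.*2.+1] is what [large_fragment] asks for, and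
   [s < 2 ^ L] is what the induction asks for. *)
pose s := r'.+1./2.
have s_lt : (s < 2 ^ L)%N.
  by rewrite ltn_half_double -mul2n -expnS.
have s_le : (s <= r')%N by rewrite -ltnS ltn_half_double -addnn -[ltnLHS]addn0 ltn_add2l.
have r_le : (r'.+1 <= s.*2.+1)%N.
  by rewrite -{1}(odd_double_half r'.+1) -/s -[leqRHS]add1n leq_add2r leq_b1.
have uL01 : prob_fun (fun e => u e *+ L).
  move=> e; have := u01 e; have := u0 e; rewrite mulrS => ? /andP[_ ?].
  by rewrite mulrn_wge0 //=; lra.
have u1 : prob_fun u.
  move=> e; have := u01 e; have := u0 e; rewrite mulrS => ? /andP[_ ?].
  by have := mulrn_wge0 L (u0 e); lra.
pose D' W := [set h in D | (#|fragment f D W h| <= s)%N].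
have IH W : #|D' W|%:R * expect (fun e => u e *+ L) (misses (fragment f D W) (D' W))
              <= M * ((1 - 5^-1 ^+ s) / 4).
  apply: IHL => // [T|h|h e].
  - apply: le_trans (sp T); rewrite ler_wpM2r ?exprn_ge0 //; first exact: ltW.
    rewrite ler_nat subset_leq_card //; apply/fintype.subsetP => h.
    rewrite !inE => /andP[/andP[hD _] Th]; rewrite hD /=.
    exact: (subset_trans Th (fragment_sub f W hD)).
  - by rewrite inE => /andP[].
  - rewrite inE => /andP[hD _] /(fintype.subsetP (fragment_sub f W hD)).
    exact: fu.
(* Members with a small fragment are left to the induction hypothesis; each of the others is counted
   as a full loss. *)
have split W : #|D|%:R * expect (fun e => u e *+ L) (fun Y => misses f D (W :|: Y)) <=
    M * ((1 - 5^-1 ^+ s) / 4) +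
    #|[set h in D | (s < #|fragment f D W h|)%N]|%:R.
  apply: le_trans (lerD (IH W) (lexx _)).
  set b := expect _ (misses (fragment _ _ _) _); set a := expect _ _.
  (* A set [Y] containing a fragment completes, together with [W], a full member of the original
     family. *)
  have ab : a <= b.
    apply: ler_expect => // Y; rewrite /misses ler_nat; case: existsP => //= h1.
    case: existsP => // -[h /andP[]]; rewrite inE => /andP[hD _] fY.
    case: h1; have [h' h'D [fE h'W _]] := fragmentP f W hD.
    by exists h'; rewrite h'D /= -subDset -fE.
  have a1 : a <= 1.
    rewrite -[leRHS](expect_cst (fun e => u e *+ L)); apply: ler_expect => // Y.
    by rewrite /misses; case: (~~ _).
  have -> : #|D| = (#|D' W| + #|[set h in D | (s < #|fragment f D W h|)%N]|)%N.
    rewrite -(cardsID [set h | (#|fragment f D W h| <= s)%N] D); congr (_ + _)%N.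
      by apply: eq_card => h; rewrite !inE.
    by apply: eq_card => h; rewrite !inE -ltnNge andbC.
  rewrite natrD mulrDl lerD //; first by rewrite ler_wpM2l.
  by rewrite -[leRHS]mulr1 ler_wpM2l.
have uL1 : forall e, 0 <= u e <= u e *+ L.+1.
  by move=> e; rewrite u0 mulrS lerDl mulrn_wge0.
have dec : increasing (fun W => 1 - misses f D W).
  move=> W Y WY; rewrite lerD2l lerN2 /misses ler_nat.
  case: existsP => //= h1; case: existsP => // -[h /andP[hD hW]].
  by case: h1; exists h; rewrite hD (subset_trans hW).
have := expect_union u01 dec uL1.
have -> : expect (fun e => u e *+ L.+1) (fun W => 1 - misses f D W) =
          1 - expect (fun e => u e *+ L.+1) (misses f D).
  rewrite -[1 in RHS](expect_cst (fun e => u e *+ L.+1)) -mulN1r -expectZ -expectD.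
  by apply: eq_expect => // W; rewrite mulN1r.
have -> : expect u (fun X => expect (fun e => u e *+ L.+1 - u e)
             (fun Y => 1 - misses f D (X :|: Y))) =
   1 - expect u (fun X => expect (fun e => u e *+ L) (fun Y => misses f D (X :|: Y))).
  rewrite -[1 in RHS](expect_cst u) -mulN1r -expectZ -expectD.
  apply: eq_expect => // X.
  rewrite -[X in _ = X + _](expect_cst (fun e => u e *+ L)) -expectZ -expectD.
  by apply: eq_expect => // [e|Y] /=; rewrite ?mulN1r // mulrS addrAC subrr add0r.
rewrite lerD2l lerN2 => un.
apply: le_trans (ler_wpM2l (ler0n _ _) un) _.
rewrite -expectZ; apply: le_trans (ler_expect u1 split) _.
rewrite expectD expect_cst.
apply: le_trans (lerD (lexx _) (large_fragment u1 sp k0 p0 pk _ fu)) _.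
  by move=> h /fr; move/leq_trans; apply.
rewrite -mulrDr ler_wpM2l //.
(* This identity is the reason for the form [(1 - 5^-1 ^+ r) / 4] of the bound: one more stage fits
   exactly. *)
have -> : (1 - 5^-1 ^+ s) / 4 + 5^-1 ^+ s.+1 = (1 - 5^-1 ^+ s.+1) / 4 :> R.
  by rewrite exprS; field.
rewrite ler_wpM2r ?invr_ge0 // lerD2l lerN2.
by rewrite ler_wiXn2l // ?invr_ge0 //; lra.
Qed.

(** With [A] independent samples, the union misses the family only if every sample does. *)
Lemma misses_amplify u f D (A : nat) : prob_fun (fun e => u e *+ A) ->
  (forall e, 0 <= u e) -> expect u (misses f D) <= 4^-1 ->
  expect (fun e => u e *+ A) (misses f D) <= 4^-1 ^+ A.
Proof.
move=> + u0 h4; elim: A => [|A IHA] uA.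
  rewrite expr0 -[leRHS](expect_cst (fun e => u e *+ 0)).
  by apply: ler_expect => // W; rewrite /misses; case: (~~ _).
have uA1 e : 0 <= u e <= u e *+ A.+1 by rewrite u0 mulrS lerDl mulrn_wge0.
have u1 : prob_fun u.
  move=> e; have /andP[_ ?] := uA e; have /andP[-> ?] := uA1 e.
  exact: le_trans (_ : u e <= u e *+ A.+1) _.
have uA01 : prob_fun (fun e => u e *+ A).
  move=> e; have := uA e; have := u0 e; rewrite mulrS => ? /andP[_ ?].
  by rewrite mulrn_wge0 //=; lra.
have dec : increasing (fun W => 1 - misses f D W).
  move=> W Y WY; rewrite lerD2l lerN2 /misses ler_nat.
  case: existsP => //= h1; case: existsP => // -[h /andP[hD hW]].
  by case: h1; exists h; rewrite hD (subset_trans hW).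
have := expect_union uA dec uA1.
have -> : expect (fun e => u e *+ A.+1) (fun W => 1 - misses f D W) =
          1 - expect (fun e => u e *+ A.+1) (misses f D).
  rewrite -[1 in RHS](expect_cst (fun e => u e *+ A.+1)) -mulN1r -expectZ -expectD.
  by apply: eq_expect => // W; rewrite mulN1r.
have sub : expect u (fun X => expect (fun e => u e *+ A.+1 - u e)
             (fun Y => 1 - misses f D (X :|: Y))) >=
   expect u (fun X => 1 + (- expect (fun e => u e *+ A) (misses f D)) * misses f D X).
  apply: ler_expect => // X.
  rewrite mulNr [X in 1 - X]mulrC -mulNr -expectZ.
  rewrite -[X in X + _](expect_cst (fun e => u e *+ A)) -expectD.
  rewrite [leRHS](@eq_expect _ _ _ (fun e => u e *+ A) _ (fun Y => 1 - misses f D (X :|: Y))) //.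
    apply: ler_expect => // Y.
    rewrite lerD2l mulNr lerN2 /misses -natrM ler_nat.
    case: existsP => //= h1.
    case: existsP => [[h /andP[hD hX]]|_].
      by case: h1; exists h; rewrite hD (subset_trans hX) ?subsetUl.
    case: existsP => // -[h /andP[hD hX]].
    by case: h1; exists h; rewrite hD (subset_trans hX) ?subsetUr.
  by move=> e /=; rewrite mulrS addrAC subrr add0r.
move=> /(le_trans sub); rewrite expectD expect_cst expectZ.
rewrite lerD2l mulNr lerN2 => /le_trans; apply.
rewrite exprSr; apply: ler_pM => //; try exact: IHA.
- by apply: expect_ge0 => // W; rewrite /misses.
- by apply: expect_ge0 => // W; rewrite /misses.
Qed.

End Spread.

Arguments misses {R E I} f D W.

(** * Perfect matchings of complete multipartite hypergraphs *)

(** Composing with the inverse of [s0] turns agreement on [X] into fixing [X] pointwise, which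
    leaves a permutation of the complement. *)
Lemma card_perm_agree (T : finType) (X : {set T}) (s0 : {perm T}) :
  (#|[set s : {perm T} | [forall t in X, s t == s0 t]]| <= (#|T| - #|X|)`!)%N.
Proof.
have -> : (#|T| - #|X|)%N = #|~: X| by rewrite [RHS]cardsCs setCK.
rewrite -card_perm.
pose h (s : {perm T}) := (s * s0^-1)%g.
have h_inj : injective h by exact: mulIg.
rewrite -(card_imset _ h_inj) subset_leq_card //.
apply/fintype.subsetP => _ /imsetP[s + ->]; rewrite inE => /forall_inP sX.
apply/fintype.subsetP => x hx; rewrite inE; apply/negP => xX; move: hx.
by rewrite !inE /h permM (eqP (sX x xX)) permK eqxx.
Qed.

Section PermutationMatchings.
Variables (k n m : nat) (iota : 'I_k.+1 -> 'I_m -> 'I_n).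
Hypothesis iota_inj : forall j, injective (iota j).

Definition tuple_edge (s : {ffun 'I_k.+1 -> {perm 'I_m}}) (t : 'I_m) :
  edge k.+1 n := [ffun j => iota j (s j t)].

Definition perm_matching (s : {ffun 'I_k.+1 -> {perm 'I_m}}) :
  {set edge k.+1 n} := [set tuple_edge s t | t : 'I_m].

(** Reindexing the labels [t] permutes the edges of a matching among themselves; making the first
    permutation trivial keeps one representative of each matching. *)
Definition normalized : {set {ffun 'I_k.+1 -> {perm 'I_m}}} :=
  [set s : {ffun 'I_k.+1 -> {perm 'I_m}} | s ord0 == 1%g].

Lemma tuple_edge_inj s : injective (tuple_edge s).
Proof.
by move=> t t' /ffunP/(_ ord0); rewrite !ffunE => /iota_inj/perm_inj.
Qed.

Lemma card_perm_matching s : #|perm_matching s| = m.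
Proof. by rewrite card_imset ?card_ord //; exact: tuple_edge_inj. Qed.

Lemma card_family_perm (B : 'I_k.+1 -> {set {perm 'I_m}}) (a : nat) :
  #|B ord0| = 1%N -> (forall j, j != ord0 -> #|B j| = a) ->
  #|family B| = (a ^ k)%N.
Proof.
move=> B0 Ba; rewrite card_family foldrE big_image /= big_ord_recl B0 mul1n.
rewrite (eq_bigr (fun=> a)) ?prod_nat_const ?card_ord // => j _.
exact: Ba.
Qed.

Lemma card_normalized : #|normalized| = (m`! ^ k)%N.
Proof.
pose B (j : 'I_k.+1) : {set {perm 'I_m}} := if j == ord0 then [set 1%g] else [set: {perm 'I_m}].
rewrite -(@card_family_perm B) /B.
- apply: eq_card => s; rewrite inE; apply/eqP/familyP => [s0 j|/(_ ord0)].
    by case: eqP => [->|_]; rewrite inE ?s0.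
  by rewrite eqxx inE => /eqP.
- by rewrite eqxx cards1.
- by move=> j /negPf ->; rewrite cardsT card_Sn.
Qed.

Variable R : realFieldType.

(** Prescribing the edges [S] prescribes each of the [k] free permutations on [#|S|] labels and
    leaves at most [(m - #|S|)!] choices for each. *)
Lemma spread_perm_matching (c : R) : 0 <= c ->
  (forall a, (a <= m)%N -> (m - a)`!%:R * c ^+ a <= m`!%:R) ->
  spread perm_matching normalized #|normalized|%:R (c ^+ k).
Proof.
move=> c0 hc S.
have [->|/set0Pn[s0]] := eqVneq [set s in normalized | S \subset perm_matching s] set0.
  by rewrite cards0 mul0r.
rewrite !inE => /andP[/eqP s00 Ss0].
pose X := [set t | tuple_edge s0 t \in S].
have XS : #|X| = #|S|.
  rewrite -(card_imset _ (@tuple_edge_inj s0)); apply: eq_card => e.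
  apply/imsetP/idP => [[t + ->]|eS]; first by rewrite inE.
  have /imsetP[t _ et] := fintype.subsetP Ss0 _ eS.
  by exists t => //; rewrite inE -et.
have Sm : (#|S| <= m)%N by rewrite -(card_perm_matching s0) subset_leq_card.
pose B (j : 'I_k.+1) : {set {perm 'I_m}} := if j == ord0 then [set 1%g] else
   [set s : {perm 'I_m} | [forall t in X, s t == s0 j t]].
have card_le : (#|[set s in normalized | S \subset perm_matching s]|
    <= (m - #|S|)`! ^ k)%N.
  apply: (@leq_trans #|family B|).
    rewrite subset_leq_card //; apply/fintype.subsetP => s.
    rewrite !inE => /andP[/eqP s0' Ss]; apply/familyP => j; rewrite /B.
    case: eqP => [->|_]; first by rewrite s0' inE.
    rewrite inE; apply/forall_inP => t; rewrite inE => tS.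
    have /imsetP[t' _ et] := fintype.subsetP Ss _ tS.
    (* As the first permutation is trivial on both sides, the vertex of an edge in the first part
       determines its label. *)
    have tt' : t = t'.
      by have /ffunP/(_ ord0) := et; rewrite !ffunE s0' s00 !perm1 => /iota_inj.
    by have /ffunP/(_ j) := et; rewrite !ffunE => /iota_inj ->; rewrite tt'.
  rewrite card_family foldrE big_image /= big_ord_recl /B eqxx cards1 mul1n.
  rewrite -[X in (_ <= _ ^ X)%N](card_ord k) -prod_nat_const.
  apply: leq_prod => j _ /=.
  by have := card_perm_agree X (s0 (lift ord0 j)); rewrite card_ord XS.
rewrite card_normalized -exprM mulnC exprM.
apply: (@le_trans _ _ (((m - #|S|)`! ^ k)%:R * c ^+ #|S| ^+ k)).
  by rewrite ler_wpM2r ?ler_nat // !exprn_ge0.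
rewrite !natrX -exprMn lerXn2r ?nnegrE ?mulr_ge0 ?exprn_ge0 //.
exact: hc.
Qed.

(** Rate [p *+ L] covers the family up to failure 1/4 by [spread_covers]; [A] repetitions bring the
    failure down to [4^-1 ^+ A]. Only tuples of vertices in the range of [iota] are exposed. *)
Lemma perm_matching_misses (c p : R) (L A : nat) :
  0 < c -> (forall a, (a <= m)%N -> (m - a)`!%:R * c ^+ a <= m`!%:R) ->
  0 < p -> 20 <= p * c ^+ k -> (m < 2 ^ L)%N -> p *+ (L * A) <= 1 ->
  expect (fun e : edge k.+1 n => if [forall j, exists t, iota j t == e j] then p *+ (L * A) else 0)
    (misses perm_matching normalized) <= 4^-1 ^+ A :> R.
Proof.
move=> c0 hc p0 pc mL pLA.
pose u (e : edge k.+1 n) : R := if [forall j, exists t, iota j t == e j] then p else 0.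
have u0 e : 0 <= u e by rewrite /u; case: ifP => // _; exact: ltW.
have uLA : prob_fun (fun e => u e *+ L *+ A).
  move=> e; rewrite !mulrn_wge0 //= /u; case: ifP => _; first by rewrite -mulrnA.
  by rewrite !mul0rn.
rewrite (@eq_expect _ _ _ (fun e => u e *+ L *+ A) _ (misses perm_matching normalized)) //; last first.
  by move=> e; rewrite /u; case: ifP => _; rewrite ?mulrnA // !mul0rn.
case: A pLA uLA => [|A] pLA uLA.
  rewrite expr0 -[leRHS](expect_cst (fun e => u e *+ L *+ 0)).
  by apply: ler_expect => // W; rewrite /misses; case: (~~ _).
apply: misses_amplify => // [e|]; first by rewrite mulrn_wge0.
have uL : prob_fun (fun e => u e *+ L).
  move=> e; have /andP[_] := uLA e; rewrite mulrS => h; rewrite mulrn_wge0 //=.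
  apply: le_trans h; rewrite lerDl mulrn_wge0 // mulrn_wge0 //.
have N0 : (0 : R) < #|normalized|%:R by rewrite card_normalized ltr0n expn_gt0 fact_gt0.
have := @spread_covers _ _ _ u perm_matching normalized #|normalized|%:R (c ^+ k) p L m
  uL u0 (spread_perm_matching (ltW c0) hc) (exprn_gt0 _ c0) p0 pc mL.
move=> /(_ (fun s _ => eq_leq (card_perm_matching s))) H.
have /H : forall h e, h \in normalized -> e \in perm_matching h -> p <= u e.
  move=> s e _ /imsetP[t _ ->]; rewrite /u; case: ifP => // /negP[].
  by apply/forallP => j; apply/existsP; exists (s j t); rewrite ffunE.
rewrite ler_pM2l // => /le_trans; apply.
have : 0 <= (5^-1 : R) ^+ m by rewrite exprn_ge0 ?invr_ge0.
by move=> ?; rewrite mulrBl mul1r lerBlDr lerDl mulr_ge0 ?invr_ge0.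
Qed.

End PermutationMatchings.

(** * Partial matchings and packings of perfect matchings *)

Section Packings.
Variables k n : nat.
Local Notation E := (edge k n).
Implicit Types (M F H Y Q B : {set E}) (e f : E).

(** Since the parts are disjoint, two edges are disjoint exactly when they differ in every
    coordinate. *)
Definition is_matching M :=
  {in M &, forall e f, e != f -> forall j, e j != f j}.

Lemma mem_edge_vertices e (v : vertex k n) :
  (v \in edge_vertices e) = (e v.1 == v.2).
Proof.
case: v => j x; apply/imsetP/eqP => /= [[i _ [-> ->]] //|<-].
by exists j.
Qed.

Lemma perfect_matchingP H M :
  reflect [/\ M \subset H, is_matching M &
              forall j x, exists2 e, e \in M & e j = x]
          (perfect_matching H M).
Proof.
apply: (iffP and3P) => [[MH /forall_inP sep /forallP cov]|[MH sep cov]].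
  split=> // [e f eM fM ef j|j x].
    have /implyP/(_ ef) := forall_inP (sep e eM) f fM.
    apply: contraTN => /eqP ej; apply/pred0Pn; exists (j, e j).
    by rewrite /= !mem_edge_vertices /= ej !eqxx.
  have /exists_inP[e eM] := cov (j, x).
  by rewrite mem_edge_vertices => /eqP; exists e.
split=> //.
  apply/forall_inP => e eM; apply/forall_inP => f fM; apply/implyP => ef.
  apply/pred0P => -[j x] /=; rewrite !mem_edge_vertices /=.
  apply/andP => -[/eqP ej /eqP fj].
  by have := sep e f eM fM ef j; rewrite ej fj eqxx.
apply/forallP => -[j x]; have [e eM ej] := cov j x.
by apply/exists_inP; exists e => //; rewrite mem_edge_vertices /= ej.
Qed.

(* [F] collects the edges of the matchings already chosen. *)
Fixpoint packs (j : nat) F H : bool :=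
  if j is i.+1 then
    [exists M : {set E},
       [&& perfect_matching H M, [disjoint M & F] & packs i (F :|: M) H]]
  else true.

Lemma packs_sub j F H Y : H \subset Y -> packs j F H -> packs j F Y.
Proof.
move=> HY; elim: j F => //= j IHj F /existsP[M /and3P[/perfect_matchingP[MH sM cM] MF pM]].
apply/existsP; exists M; rewrite MF IHj // !andbT.
by apply/perfect_matchingP; split=> //; exact: subset_trans HY.
Qed.

Lemma packs_cover j F H M : perfect_matching H M -> [disjoint M & F] ->
  packs j (F :|: M) H -> packs j.+1 F H.
Proof. by move=> pM MF pj /=; apply/existsP; exists M; rewrite pM MF. Qed.

Definition compatible M e := [forall f in M, [forall j, f j != e j]].

Lemma compatibleP M e :
  reflect (forall f, f \in M -> forall j, f j != e j) (compatible M e).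
Proof.
apply: (iffP forall_inP) => h f fM; first exact/forallP/h.
exact/forallP/h.
Qed.

Lemma compatible_setU1 M e f : compatible (e |: M) f -> compatible M f.
Proof. by move=> /compatibleP h; apply/compatibleP => x xM; apply: h; rewrite setU1r. Qed.

Lemma is_matching_setU1 M e : compatible M e -> is_matching M -> is_matching (e |: M).
Proof.
move=> /compatibleP Me sM x y /setU1P[->|xM] /setU1P[->|yM] //.
- by rewrite eqxx.
- by move=> _ j; rewrite eq_sym; exact: Me.
- by move=> _ j; exact: Me.
- exact: sM.
Qed.

Definition uncovered M j : {set 'I_n} := ~: [set e j | e : E in M].

Lemma card_uncovered M j : is_matching M -> #|uncovered M j| = (n - #|M|)%N.
Proof.
move=> sM; rewrite cardsCs finset.setCK card_ord card_in_imset // => e f eM fM ef.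
by apply/eqP; apply: contraT => /(sM e f eM fM)/(_ j); rewrite ef eqxx.
Qed.

Lemma compatible_uncovered M e : compatible M e = [forall j, e j \in uncovered M j].
Proof.
apply/compatibleP/forallP => [h j|h f fM j].
  rewrite inE; apply/imsetP => -[f fM ej].
  by have := h f fM j; rewrite ej eqxx.
have := h j; rewrite inE; apply: contraNneq => <-.
exact: imset_f.
Qed.

Lemma card_compatible M : is_matching M -> #|[set e | compatible M e]| = ((n - #|M|) ^ k)%N.
Proof.
move=> sM; have -> : #|[set e | compatible M e]| = #|family (uncovered M)|.
  by apply: eq_card => e; rewrite inE compatible_uncovered; apply/forallP/familyP.
rewrite card_family foldrE big_image /=.
by rewrite (eq_bigr _ (fun j _ => card_uncovered j sM)) prod_nat_const card_ord.
Qed.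

End Packings.

(** There is at least one vertex, so a perfect matching is nonempty; disjointness from the earlier
    matchings then makes it a new member, and exactly [j] members result. *)
Lemma packs_family k n j (F H : {set edge k.+1 n.+1}) : packs j F H ->
  exists C : {set {set edge k.+1 n.+1}},
    [/\ #|C| = j, edge_disjoint_perfect_matchings H C &
        forall M, M \in C -> [disjoint M & F]].
Proof.
elim: j F => [|j IHj] F /=.
  exists set0; rewrite cards0; split=> // [|M]; last by rewrite inE.
  by apply/andP; split; apply/forall_inP => M; rewrite inE.
move=> /existsP[M /and3P[pM MF /IHj[C [Cj /andP[/forall_inP Cp /forall_inP Cd] CF]]]].
have CM M' : M' \in C -> [disjoint M' & M] /\ [disjoint M' & F].
  by move=> /CF; rewrite -!setI_eq0 setIUr setU_eq0 => /andP[].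
have MC : M \notin C.
  apply/negP => /CM[]; have [_ _ /(_ ord0 ord0)[e eM _]] := perfect_matchingP _ _ pM.
  by move=> /pred0P/(_ e) /=; rewrite eM.
exists (M |: C); split; first by rewrite cardsU1 MC Cj.
  apply/andP; split; apply/forall_inP => M1 /setU1P[->|M1C] //; first exact: Cp.
    apply/forall_inP => M2 /setU1P[->|M2C]; first by rewrite eqxx.
    by apply/implyP => _; rewrite disjoint_sym; have [] := CM _ M2C.
  apply/forall_inP => M2 /setU1P[->|M2C]; last exact: (forall_inP (Cd _ M1C)).
  by apply/implyP => _; have [] := CM _ M1C.
by move=> M' /setU1P[->//|/CM[]].
Qed.

(** * One round: greedy matching and completion *)

Section Shift.
Variables k n : nat.
Local Notation E := (edge k n.+1).
Implicit Types (M F H : {set E}) (e f g : E).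

(** Addition in ['I_n.+1] is modular, so this is a translation of the group [(Z/(n+1))^k]; edges
    also serve as the group elements. *)
Definition translate g e : E := [ffun i => e i + g i].

Lemma translateC g e : translate g e = translate e g.
Proof. by apply/ffunP => i; rewrite !ffunE addrC. Qed.

Definition untranslate g e : E := [ffun i => e i - g i].

Lemma translateK g : cancel (translate g) (untranslate g).
Proof. by move=> e; apply/ffunP => i; rewrite !ffunE addrK. Qed.

Lemma untranslateK g : cancel (untranslate g) (translate g).
Proof. by move=> e; apply/ffunP => i; rewrite !ffunE subrK. Qed.

Lemma translate_bij g : bijective (translate g).
Proof. by exists (untranslate g); [exact: translateK | exact: untranslateK]. Qed.

Lemma translate_inj g : injective (translate g).
Proof. exact: can_inj (translateK g). Qed.

Lemma perfect_matching_translate g H M :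
  perfect_matching H M -> perfect_matching (translate g @: H) (translate g @: M).
Proof.
move=> /perfect_matchingP[MH sM cM]; apply/perfect_matchingP; split.
- exact: imsetS.
- move=> _ _ /imsetP[e eM ->] /imsetP[f fM ->] ef j.
  rewrite !ffunE (inj_eq (addIr _)); apply: sM => //.
  by apply: contraNneq ef => ->.
- move=> j x; have [e eM ej] := cM j (x - g j).
  by exists (translate g e); [exact: imset_f | rewrite ffunE ej subrK].
Qed.

Lemma packs_translate g j F H :
  packs j F H -> packs j (translate g @: F) (translate g @: H).
Proof.
elim: j F => //= j IHj F /existsP[M /and3P[pM MF pj]].
apply/existsP; exists (translate g @: M); rewrite perfect_matching_translate //=.
rewrite -imsetU IHj // andbT.
by rewrite -!setI_eq0 in MF *; rewrite -imsetI ?(eqP MF) ?imset0 // => ? ? _ _ /translate_inj.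
Qed.

(** Translations relabel vertices and preserve perfect matchings. A lower bound for translated
    budgets and used edges therefore holds for the original ones, which permits averaging over all
    translations. *)
Lemma expect_packs_translate (R : realFieldType) (u : E -> R) g j F : prob_fun u ->
  expect (fun e => u (translate g e)) (fun H => (packs j (translate g @^-1: F) H)%:R)
    <= expect u (fun H => (packs j F H)%:R).
Proof.
move=> u01; rewrite /expect.
rewrite [leRHS](reindex_onto (fun H => translate g @: H) (fun H => translate g @^-1: H)) /=; last first.
  move=> H _; apply/setP => e; apply/imsetP/idP => [[f + ->]|eH]; first by rewrite inE.
  by exists (untranslate g e); rewrite ?inE untranslateK.
rewrite [leRHS](eq_bigl xpredT); last first.
  move=> H; apply/eqP/setP => e; rewrite inE mem_imset //; exact: translate_inj.
apply: ler_sum => H _.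
have -> : mass u (translate g @: H) = mass (fun e => u (translate g e)) H.
  rewrite /mass (reindex (translate g)) /=; last exact/onW_bij/translate_bij.
  by apply: eq_bigr => e _; rewrite mem_imset //; exact: translate_inj.
rewrite ler_wpM2l //; first by apply: mass_ge0 => e; exact: u01.
rewrite ler_nat; case: (boolP (packs j _ H)) => // /(packs_translate g).
have -> : translate g @: (translate g @^-1: F) = F.
  apply/setP => e; apply/imsetP/idP => [[f + ->]|eF]; first by rewrite inE.
  by exists (untranslate g e); rewrite ?inE untranslateK.
by move=> ->.
Qed.

(** Exactly one translation sends a given edge of [M] to a given edge of [F]. *)
Lemma sum_translate_card F M : (\sum_g #|M :&: translate g @^-1: F| = #|M| * #|F|)%N.
Proof.
transitivity (\sum_g \sum_(e in M) (translate g e \in F : nat))%N.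
  apply: eq_bigr => g _; rewrite -sum1_card big_mkcond [RHS]big_mkcond /=.
  by apply: eq_bigr => e _; rewrite !inE; case: (e \in M); case: (_ \in F).
rewrite exchange_big /= -sum_nat_const; apply: eq_bigr => e _.
rewrite -sum1_card [RHS](reindex (translate e)) /=; last exact/onW_bij/translate_bij.
rewrite [RHS]big_mkcond; apply: eq_bigr => g _; rewrite translateC.
by case: (_ \in F).
Qed.

End Shift.

(** * The greedy matching and its expectation *)

Section Greedy.
Variables (R : realFieldType) (k n b : nat) (q : R).
Hypothesis q01 : 0 <= q <= 1.
Local Notation E := (edge k.+1 n).
Implicit Types (M Q B H : {set E}) (e f : E) (l : seq E)
  (F G : {set E} -> {set E} -> R).

(* Expectation of [F M Q] over the greedy matching [M] that scans [l], querying
   with probability [q] every edge disjoint from the current matching until [b]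
   edges are accepted; [Q] is the set of queried edges. *)
Fixpoint greedy l M Q F : R :=
  if l is e :: l' then
    if compatible M e && (#|M| < b)%N then
      (1 - q) * greedy l' M (e |: Q) F + q * greedy l' (e |: M) (e |: Q) F
    else greedy l' M Q F
  else F M Q.

Let q0 : 0 <= q. Proof. by case/andP: q01. Qed.
Let q1 : 0 <= 1 - q. Proof. by rewrite subr_ge0; case/andP: q01. Qed.

(** [P] is an invariant of acceptance, so [F] and [G] need comparing only on matchings that satisfy
    it. *)
Lemma greedy_le (P : {set E} -> Prop) l M Q F G :
  (forall M e, compatible M e -> (#|M| < b)%N -> P M -> P (e |: M)) ->
  (forall M Q, P M -> F M Q <= G M Q) -> P M ->
  greedy l M Q F <= greedy l M Q G.
Proof.
move=> Pe FG; elim: l M Q => [|e l IHl] M Q PM /=; first exact: FG.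
case: ifPn => [/andP[eM Mb]|_]; last exact: IHl.
by rewrite lerD // ler_wpM2l // IHl //; exact: Pe.
Qed.

Lemma greedy_cst l M Q (a : R) : greedy l M Q (fun _ _ => a) = a.
Proof.
elim: l M Q => //= e l IHl M Q; case: ifP => _; rewrite !IHl //.
by rewrite mulrBl mul1r subrK.
Qed.

Lemma greedyD l M Q F G :
  greedy l M Q (fun M Q => F M Q + G M Q) = greedy l M Q F + greedy l M Q G.
Proof.
elim: l M Q => //= e l IHl M Q; case: ifP => _; rewrite !IHl //.
by ring.
Qed.

Lemma greedyZ l M Q (a : R) F :
  greedy l M Q (fun M Q => a * F M Q) = a * greedy l M Q F.
Proof.
elim: l M Q => //= e l IHl M Q; case: ifP => _; rewrite !IHl //.
by ring.
Qed.

Lemma greedy_sum l M Q (I : finType) (P : pred I) (F : I -> {set E} -> {set E} -> R) :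
  greedy l M Q (fun M Q => \sum_(i | P i) F i M Q) =
  \sum_(i | P i) greedy l M Q (F i).
Proof.
elim: l M Q => //= e l IHl M Q; case: ifP => _; rewrite !IHl //.
by rewrite !mulr_sumr -big_split.
Qed.

(* Value of the rest of the process once the queries to [Q] are charged to the
   budget [u]; exceeding a budget counts as failure. *)
Definition residual (u : E -> R) (Fm : {set E} -> R) M Q : R :=
  if [forall e in Q, q <= u e]
  then expect (fun e => u e - q *+ (e \in Q)) (fun H => Fm (M :|: H)) else 0.

(** Every query is an instance of [expect_query] for an edge not queried before. If the query would
    overdraw a budget, both branches have value zero and nothing is to be shown. *)
Lemma greedy_dominated l M Q (u : E -> R) (Fm : {set E} -> R) :
  prob_fun u -> increasing Fm -> (forall H, 0 <= Fm H) ->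
  uniq l -> (forall e, e \in l -> e \notin Q) ->
  greedy l M Q (residual u Fm) <= residual u Fm M Q.
Proof.
move=> u01 Fi F0; set V := residual u Fm.
have uQ (Q' : {set E}) : [forall e in Q', q <= u e] -> prob_fun (fun e => u e - q *+ (e \in Q')).
  move=> /forall_inP qu e; have /andP[? ?] := u01 e.
  case: (boolP (e \in Q')) => [/qu ?|_]; rewrite ?mulr1n ?mulr0n; last lra.
  by apply/andP; split; have := q0; lra.
have V0 M' Q' : 0 <= V M' Q'.
  by rewrite /V /residual; case: ifP => // /uQ h; exact: expect_ge0.
elim: l M Q => [|e l IHl] M Q //= /andP[el ul] lQ.
have lQ' x : x \in l -> x \notin Q by move=> xl; apply: lQ; rewrite inE xl orbT.
case: ifPn => [_|_]; last exact: IHl.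
have leQ x : x \in l -> x \notin e |: Q.
  move=> xl; rewrite in_setU1 negb_or lQ' // andbT.
  by apply: contraNneq el => <-.
apply: le_trans (_ : (1 - q) * V M (e |: Q) + q * V (e |: M) (e |: Q) <= _).
  by rewrite lerD // ler_wpM2l // IHl.
have eQ : e \notin Q by apply: lQ; rewrite inE eqxx.
case: (boolP [forall x in e |: Q, q <= u x]) => [h|h]; last first.
  by rewrite {1 2}/V /residual (negPf h) !mulr0 addr0.
have hQ : [forall x in Q, q <= u x].
  by apply/forall_inP => x xQ; apply: (forall_inP h); rewrite setU1r.
have he : q <= u e by apply: (forall_inP h); rewrite setU11.
rewrite /V /residual h hQ.
have Fi' : increasing (fun H => Fm (M :|: H)).
  by move=> A C AC; apply: Fi; exact: setUS.
have := @expect_query _ _ _ e q _ (uQ _ hQ) Fi'.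
rewrite (negPf eQ) mulr0n subr0 q0 he => /(_ isT); apply: le_trans.
rewrite le_eqVlt; apply/orP; left; apply/eqP.
have E1 x : u x - q *+ (x \in e |: Q) = spend (fun e => u e - q *+ (e \in Q)) e q x.
  rewrite /spend in_setU1; case: eqP => [->|_] /=; rewrite ?mulr0n ?subr0 //.
  by rewrite (negPf eQ) mulr0n subr0.
by congr (_ * _ + _ * _); apply: eq_expect => // H; rewrite setUCA setUA.
Qed.

(* Every accepted edge costs one successful query, so the greedy matching
   pays in expectation exactly its size. *)
Lemma greedy_cost l M Q : uniq l -> (forall e, e \in l -> e \notin Q) ->
  greedy l M Q (fun M Q => #|M|%:R - q * #|Q|%:R) = #|M|%:R - q * #|Q|%:R.
Proof.
elim: l M Q => //= e l IHl M Q /andP[el ul] lQ.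
have lQ' x : x \in l -> x \notin Q by move=> xl; apply: lQ; rewrite inE xl orbT.
case: ifPn => [/andP[eM _]|_]; last exact: IHl.
have leQ x : x \in l -> x \notin e |: Q.
  move=> xl; rewrite in_setU1 negb_or lQ' // andbT.
  by apply: contraNneq el => <-.
rewrite !IHl // !cardsU1 lQ ?inE ?eqxx //.
have -> : e \notin M.
  by apply/negP => /(compatibleP _ _ eM)/(_ ord0); rewrite eqxx.
by rewrite !add1n -!natr1; ring.
Qed.

(** If the final matching is too small and disjoint from all of [B], then each edge of [B] was
    compatible when it was scanned, hence queried, and its query failed; this costs a factor [1 - q]
    per edge. *)
Lemma greedy_avoid B l M Q :
  greedy l M Q (fun M _ => ((#|M| < b)%N && [forall e in B, compatible M e])%:R)
    <= (1 - q) ^+ count [in B] l.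
Proof.
elim: l M Q => [|e l IHl] M Q /=; first by rewrite expr0 lern1 leq_b1.
(* Once a persistent property [P] excludes the event, its probability is zero. *)
have step (P : {set E} -> Prop) M' Q' :
    (forall M e, compatible M e -> (#|M| < b)%N -> P M -> P (e |: M)) ->
    (forall M, P M -> ~~ ((#|M| < b)%N && [forall e in B, compatible M e])) -> P M' ->
    greedy l M' Q' (fun M _ => ((#|M| < b)%N && [forall e in B, compatible M e])%:R) <= 0.
  move=> Pe PB PM; rewrite -[leRHS](greedy_cst l M' Q' 0); apply: greedy_le Pe _ PM.
  by move=> M'' _ /PB/negPf ->.
case: (boolP (e \in B)) => eB; last first.
  rewrite add0n; case: ifP => _; last exact: IHl.
  rewrite -[leRHS]mul1r -[X in _ <= X * _](subrK q 1) [leRHS]mulrDl.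
  by rewrite lerD // ler_wpM2l.
rewrite add1n exprS; case: ifPn => [_|].
  rewrite -[leRHS]addr0 lerD ?ler_wpM2l //.
  rewrite mulr_ge0_le0 // (step (fun M => e \in M)) ?setU11 //.
    by move=> M' e' _ _ eM'; rewrite setU1r.
  move=> M' eM'; rewrite negb_and; apply/orP; right.
  apply/negP => /forall_inP/(_ e eB)/compatibleP/(_ e eM')/(_ ord0).
  by rewrite eqxx.
(* An unqueried edge of [B] either meets the matching or finds it already full; both persist and
   exclude the event. *)
rewrite negb_and => h; apply: le_trans (_ : 0 <= _); last first.
  by rewrite mulr_ge0 ?exprn_ge0.
case/orP: h => h.
  apply: (step (fun M => ~~ compatible M e)) => // [M' e' _ _|M' h'].
    by apply: contraNN; exact: compatible_setU1.
  rewrite negb_and; apply/orP; right; apply: contraNN h' => /forall_inP.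
  exact.
apply: (step (fun M => ~~ (#|M| < b)%N)) => // [M' e' _ -> //|M' h'].
by rewrite negb_and h'.
Qed.

End Greedy.

(** Union bound over the sets [U j] of uncovered vertices. When the matching stays below [n - m]
    edges each has size at least [m], so the box they span contains at least [m ^ k.+1] tuples, all
    compatible with the final matching, and [greedy_avoid] applies. *)
Lemma greedy_incomplete (R : realFieldType) (k n m : nat) (q : R) :
  0 <= q <= 1 -> (m <= n)%N ->
  greedy (n - m) q (enum (edge k.+1 n)) set0 set0
    (fun M _ => (#|M| < n - m)%N%:R)
  <= ((2 ^ n) ^ k.+1)%:R * (1 - q) ^+ (m ^ k.+1).
Proof.
move=> q01 mn; set b := (n - m)%N.
pose B (U : {ffun 'I_k.+1 -> {set 'I_n}}) : {set edge k.+1 n} := [set e in family (fun j => U j)].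
pose P := is_matching (k := k.+1) (n := n).
apply: le_trans (_ : greedy b q (enum (edge k.+1 n)) set0 set0 (fun M _ =>
    \sum_(U : {ffun 'I_k.+1 -> {set 'I_n}} | [forall j, (m <= #|U j|)%N])
     ((#|M| < b)%N && [forall e in B U, compatible M e])%:R) <= _).
  apply: (@greedy_le _ _ _ _ _ q01 P) => [M e eM _|M _ sM|e f]; last by rewrite inE.
    exact: is_matching_setU1.
  case: (ltnP #|M| b) => Mb; last by apply: sumr_ge0.
  pose U : {ffun 'I_k.+1 -> {set 'I_n}} := [ffun j => uncovered M j].
  rewrite (bigD1 U) /=; last first.
    apply/forallP => j; rewrite ffunE card_uncovered //.
    have Mb' := ltnW Mb.
    rewrite leq_subRL; last exact: leq_trans Mb' (leq_subr _ _).
    by move: Mb'; rewrite /b leq_subRL // addnC.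
  apply: ler_wpDr; first by apply: sumr_ge0.
  rewrite /= ler_nat lt0b; apply/forall_inP => e; rewrite inE => /familyP eU.
  by rewrite compatible_uncovered; apply/forallP => j; have := eU j; rewrite ffunE.
rewrite greedy_sum.
apply: le_trans (_ : \sum_(U : {ffun 'I_k.+1 -> {set 'I_n}}) (1 - q) ^+ (m ^ k.+1) <= _); last first.
  have cT : #|{set 'I_n}| = (2 ^ n)%N.
    by rewrite -cardsT -powersetT card_powerset cardsT card_ord.
  by rewrite sumr_const card_ffun cT card_ord mulr_natl.
rewrite big_mkcond; apply: ler_sum => U _.
have q1 : 0 <= 1 - q by rewrite subr_ge0; case/andP: q01.
case: ifPn => [/forallP mU|_]; last exact: exprn_ge0.
apply: (le_trans (greedy_avoid b q01 (B U) _ set0 set0)).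
have -> : count [in B U] (enum (edge k.+1 n)) = #|family (fun j => U j)|.
  rewrite -size_filter cardE; congr size; rewrite /enum_mem -filter_predI.
  by apply: eq_filter => e; rewrite /= !inE andbT.
apply: ler_wiXn2l => //; first by rewrite lerBlDr lerDl; case/andP: q01.
rewrite card_family foldrE big_image /= -[X in (_ ^ X)%N](card_ord k.+1) -prod_nat_const.
exact: leq_prod.
Qed.

(** * Completing a partial matching on its uncovered vertices *)

Section Completion.
Variables k n m : nat.
Local Notation E := (edge k n.+1).
Implicit Types (M Y H : {set E}) (e : E).

(** The default [ord0] is not reached when [M] is a matching with [n.+1 - m] edges and [m <= n.+1]:
    exactly [m] vertices of the part are then uncovered. *)
Definition leftover M j (t : 'I_m) : 'I_n.+1 := nth ord0 (enum (uncovered M j)) t.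

Lemma size_leftover M j : is_matching M -> #|M| = (n.+1 - m)%N -> (m <= n.+1)%N ->
  size (enum (uncovered M j)) = m.
Proof. by move=> sM Mb mn; rewrite -cardE card_uncovered // Mb subKn. Qed.

Lemma leftover_inj M j : is_matching M -> #|M| = (n.+1 - m)%N -> (m <= n.+1)%N ->
  injective (leftover M j).
Proof.
move=> sM Mb mn t t' /eqP; rewrite /leftover nth_uniq ?enum_uniq ?size_leftover //.
by move=> /eqP/val_inj.
Qed.

Lemma leftoverP M j x : is_matching M -> #|M| = (n.+1 - m)%N -> (m <= n.+1)%N ->
  reflect (exists t, leftover M j t = x) (x \in uncovered M j).
Proof.
move=> sM Mb mn; rewrite -mem_enum; apply: (iffP idP) => [xU|[t <-]]; last first.
  by rewrite mem_nth // size_leftover.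
have it : (index x (enum (uncovered M j)) < m)%N.
  by rewrite -[X in (_ < X)%N](size_leftover j sM Mb mn) index_mem.
by exists (Ordinal it); rewrite /leftover /= nth_index.
Qed.

Lemma compatible_leftover M e : is_matching M -> #|M| = (n.+1 - m)%N ->
  (m <= n.+1)%N -> compatible M e = [forall j, exists t, leftover M j t == e j].
Proof.
move=> sM Mb mn; rewrite compatible_uncovered; apply: eq_forallb => j.
apply/(leftoverP j _ sM Mb mn)/existsP => -[t h]; exists t; first exact/eqP.
by rewrite (eqP h).
Qed.
End Completion.

Lemma leftover_completion k n m (M Y H : {set edge k.+1 n.+1}) s :
  is_matching M -> #|M| = (n.+1 - m)%N -> (m <= n.+1)%N ->
  perm_matching (leftover (m := m) M) s \subset Y ->
  perfect_matching (M :|: (Y :|: H)) (M :|: perm_matching (leftover (m := m) M) s).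
Proof.
move=> sM Mb mn sY; apply/perfect_matchingP.
have cM e f : e \in M -> f \in perm_matching (leftover (m := m) M) s ->
    forall j, e j != f j.
  move=> eM /imsetP[t _ ->].
  suff /compatibleP/(_ e eM) : compatible M (tuple_edge (leftover (m := m) M) s t) by [].
  rewrite (compatible_leftover _ sM Mb mn); apply/forallP => j; apply/existsP.
  by exists (s j t); rewrite ffunE.
split.
- by rewrite setUS // subsetU // sY.
- move=> e f /setUP[eM|eN] /setUP[fM|fN] ef j.
  + exact: sM.
  + exact: cM.
  + by rewrite eq_sym; exact: cM.
  + move: eN fN ef => /imsetP[t _ ->] /imsetP[t' _ ->]; rewrite !ffunE.
    apply: contraNneq => /(leftover_inj sM Mb mn)/perm_inj -> //.
- move=> j x; case: (boolP (x \in uncovered M j)).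
    move=> /(leftoverP j x sM Mb mn)[t <-].
    exists (tuple_edge (leftover (m := m) M) s ((s j)^-1%g t)).
      by rewrite inE imset_f ?orbT.
    by rewrite ffunE permKV.
  rewrite inE negbK => /imsetP[e eM ->]; exists e => //.
  by rewrite inE eM.
Qed.

(** From [1 - x <= expR (- x)] follows [(1 - x) * expR x <= 1], while [(1 + x + 2 * x ^+ 2) * (1 -
    x) = 1 + x ^+ 2 * (1 - 2 * x)] is at least 1. *)
Lemma expR_le_quadratic (R : realType) (x : R) : 0 <= x <= 2^-1 ->
  expR x <= 1 + x + 2 * x ^+ 2.
Proof.
move=> /andP[x0 x1]; have e1 := expR_ge1Dx (- x).
have e0 := expR_gt0 x.
have ee : expR (- x) * expR x = 1 by rewrite expRN mulVf // gt_eqF.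
have h : (1 - x) * expR x <= 1 by rewrite -[leRHS]ee ler_wpM2r // ltW.
have x2 : 0 <= x ^+ 2 * (1 - 2 * x).
  rewrite mulr_ge0 ?sqr_ge0 //; lra.
have h2 : 1 <= (1 + x + 2 * x ^+ 2) * (1 - x).
  rewrite -subr_ge0; apply: le_trans x2 _; rewrite le_eqVlt; apply/orP; left.
  by apply/eqP; ring.
have x3 : 0 <= 1 + x + 2 * x ^+ 2.
  by have := sqr_ge0 x; lra.
apply: le_trans (_ : (1 + x + 2 * x ^+ 2) * ((1 - x) * expR x) <= _).
  by rewrite mulrA -[leLHS]mul1r ler_wpM2r // ltW.
by rewrite -[leRHS]mulr1 ler_wpM2l.
Qed.

(** Bookkeeping for the overlap term of [potential]: a round meets the [a] used edges in proportion
    to [a] and adds at most [N] used edges. *)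
Lemma overlap_count (a j N : nat) :
  (a + (j * (a + N) + j * j * N) <= j.+1 * a + j.+1 * j.+1 * N)%N.
Proof. by rewrite !mulSn !mulnS !mulnDr !mulnDl; lia. Qed.

(** * The potential function and the induction over rounds *)

Section Potential.
Variables (R : realType) (k n m A L : nat) (q p0 c lam : R).
Hypotheses (mn : (m <= n.+1)%N) (q01 : 0 <= q <= 1) (c0 : 0 < c).
Hypothesis hc : forall a, (a <= m)%N -> (m - a)`!%:R * c ^+ a <= m`!%:R.
Hypotheses (p00 : 0 < p0) (p0c : 20 <= p0 * c ^+ k) (mL : (m < 2 ^ L)%N).
Let q2 : R := p0 *+ (L * A).
Let W := q + q2.
Hypotheses (q21 : q2 <= 1) (lam0 : 0 <= lam) (lamW : lam * W <= 2^-1).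

Local Notation E := (edge k.+1 n.+1).
Local Notation b := (n.+1 - m)%N.
Implicit Types (M Q F Y H : {set E}) (e g : E) (u : E -> R).

Definition completion_prob M e : R :=
  if (#|M| == b) && compatible M e then q2 else 0.

Definition cost M Q e : R := q *+ (e \in Q) + completion_prob M e.

Definition round_matching M Y : {set E} :=
  M :|: selected (perm_matching (leftover (m := m) M)) (normalized k m) Y.

Definition round_misses M Y : R :=
  (#|M| == b)%:R * misses (perm_matching (leftover (m := m) M)) (normalized k m) Y.

Definition round_failure : R := ((2 ^ n.+1) ^ k.+1)%:R * (1 - q) ^+ (m ^ k.+1) + 4^-1 ^+ A.

(** Bounds the expected total cost of a round: by [greedy_cost] the queries cost on average the size
    of the greedy matching, and completion charges [q2] to each of [m ^ k.+1] tuples. *)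
Definition mean_cost : R := n.+1%:R + q2 * (m ^ k.+1)%:R.

(** Mean growth of [load] in one round: a random translation spreads the cost evenly over all
    tuples, and [1 + 2 * (lam * W)] absorbs the error in linearising the exponential. *)
Definition load_growth : R :=
  1 + lam * (1 + 2 * (lam * W)) * mean_cost / (n.+1 ^ k.+1)%:R.

(** The exponential sum of a Chernoff bound, with the union over edges built in: it exceeds 1 as
    soon as one budget is overdrawn. *)
Definition load u : R := \sum_e expR (- (lam * u e)).

(* Failure bound when [j] rounds remain, [a] edges are already used and [u] is
   the remaining budget of each edge. *)
Definition potential (j a : nat) u : R :=
  j%:R * round_failure + (j * a + j * j * n.+1)%:R / (n.+1 ^ k)%:R + load_growth ^+ j * load u.

Let q20 : 0 <= q2. Proof. exact/mulrn_wge0/ltW. Qed.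
Let q0 : 0 <= q. Proof. by case/andP: q01. Qed.
Let W0 : 0 <= W. Proof. exact: addr_ge0. Qed.
Let lamW0 : 0 <= lam * W. Proof. exact: mulr_ge0. Qed.

Let mean_cost0 : 0 <= mean_cost.
Proof. by rewrite addr_ge0 // mulr_ge0. Qed.

Let load_growth_ge1 : 1 <= load_growth.
Proof.
rewrite lerDl divr_ge0 // mulr_ge0 // mulr_ge0 // addr_ge0 // mulr_ge0 //.
Qed.

Let round_failure_ge0 : 0 <= round_failure.
Proof.
rewrite addr_ge0 ?mulr_ge0 ?exprn_ge0 ?invr_ge0 // subr_ge0.
by case/andP: q01.
Qed.

Lemma completion_prob_ge0 M e : 0 <= completion_prob M e.
Proof. by rewrite /completion_prob; case: ifP. Qed.

Lemma cost_bounds M Q e : 0 <= cost M Q e <= W.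
Proof.
rewrite /cost addr_ge0 ?mulrn_wge0 ?completion_prob_ge0 //= lerD //.
  by case: (_ \in _); rewrite ?mulr1n ?mulr0n.
by rewrite /completion_prob; case: ifP.
Qed.

Lemma load_ge0 u : 0 <= load u.
Proof. by apply: sumr_ge0 => e _; exact: expR_ge0. Qed.

Lemma potential_ge0 j a u : 0 <= potential j a u.
Proof.
have t0 : 0 <= load_growth by exact: le_trans load_growth_ge1.
by rewrite !addr_ge0 ?mulr_ge0 ?exprn_ge0 ?load_ge0 // invr_ge0.
Qed.

Lemma potential_exceeded j a u e : u e < 0 -> 1 <= potential j a u.
Proof.
move=> ue; rewrite /potential; apply: ler_wpDl.
  by rewrite addr_ge0 ?mulr_ge0 // invr_ge0.
apply: le_trans (_ : 1 * 1 <= _); first by rewrite mulr1.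
apply: ler_pM => //; first exact: exprn_ege1.
rewrite /load (bigD1 e) //= -[leLHS]addr0 lerD //.
  by rewrite -expR0 ler_expR oppr_ge0 mulr_ge0_le0 // ltW.
by apply: sumr_ge0 => f _; exact: expR_ge0.
Qed.

Lemma potential_mono j a a' u : (a <= a')%N -> potential j a u <= potential j a' u.
Proof.
move=> aa; rewrite /potential !lerD // ler_wpM2r ?invr_ge0 // ler_nat.
by rewrite leq_add2r leq_mul2l aa orbT.
Qed.

Lemma card_round_matching M Y : (#|M| <= b)%N -> (#|round_matching M Y| <= n.+1)%N.
Proof.
move=> Mb; apply: leq_trans (leq_of_leqif (leq_card_setU _ _)) _.
rewrite -[leqRHS](subnK mn) leq_add //.
rewrite /selected; case: pickP => [s _|_]; last by rewrite cards0.
by rewrite (leq_trans (leq_imset_card _ _)) // card_ord.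
Qed.

(** Lower bound on the success probability given the outcome of one round; any failure makes it
    nonpositive. The number of reused edges stands in for the indicator of reuse, because it
    averages linearly. *)
Definition round_value j u F M Q Y : R :=
  1 - (#|M| < b)%N%:R - round_misses M Y - #|round_matching M Y :&: F|%:R
    - potential j (#|F| + n.+1) (fun e => u e - cost M Q e).

Definition good_packing j := forall u F, prob_fun u ->
  1 - potential j #|F| u <= expect u (fun H => (packs j F H)%:R).

(** The budget [u] is split in three: the greedy queries are charged through [residual], the
    completion sample through [expect_union], and the remainder serves the other [j] rounds. *)
Lemma round_dominated j u F : good_packing j -> prob_fun u ->
  greedy b q (enum E) set0 set0
    (fun M Q => expect (completion_prob M) (round_value j u F M Q))
  <= expect u (fun H => (packs j.+1 F H)%:R).
Proof.
move=> IH u01; pose Fm H : R := (packs j.+1 F H)%:R.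
have Fi : increasing Fm.
  move=> H Y HY; rewrite /Fm ler_nat; case: (boolP (packs _ _ H)) => // h.
  by rewrite (packs_sub HY h).
have cp01 M : prob_fun (completion_prob M).
  by move=> e; rewrite completion_prob_ge0 /= /completion_prob; case: ifP => _; rewrite ?ler01.
have le0 M Q : (forall Y, round_value j u F M Q Y <= 0) ->
    expect (completion_prob M) (round_value j u F M Q) <= 0.
  move=> h; rewrite -[leRHS](expect_cst (completion_prob M)).
  exact: ler_expect.
have rm0 M Y : 0 <= round_misses M Y by rewrite mulr_ge0.
apply: (@le_trans _ _ (greedy b q (enum E) set0 set0 (residual q u Fm))); last first.
  apply: le_trans (greedy_dominated b q01 set0 u01 Fi _ _ _) _ => //.
  - exact: enum_uniq.
  - by move=> e _; rewrite inE.
  rewrite /residual; case: ifP => _.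
    rewrite (@eq_expect _ _ _ u _ Fm) // => [e|H]; last by rewrite set0U.
    by rewrite inE subr0.
  by apply: expect_ge0 => // H.
apply: (@greedy_le _ _ _ _ _ q01 (fun M => is_matching M /\ (#|M| <= b)%N))
   => [M e eM Mb [sM _]|M Q [sM Mb]|].
- split; first exact: is_matching_setU1.
  by rewrite cardsU1; case: (_ \notin _) => //; exact: ltnW.
- have bad : (exists e, u e - cost M Q e < 0) ->
      expect (completion_prob M) (round_value j u F M Q) <= 0.
    move=> [e ue]; apply: le0 => Y.
    have := @potential_exceeded j (#|F| + n.+1) (fun e => u e - cost M Q e) e ue.
    have := rm0 M Y; have := ler0n R #|round_matching M Y :&: F|.
    have := ler0n R (#|M| < b)%N.
    by rewrite /round_value; lra.
  have res0 : 0 <= residual q u Fm M Q.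
    rewrite /residual; case: ifP => // /forall_inP qu; apply: expect_ge0 => // e.
    have /andP[? ?] := u01 e.
    case: (boolP (e \in Q)) => [/qu ?|_]; rewrite ?mulr1n ?mulr0n; last lra.
    by apply/andP; split; have := q0; lra.
  have [/existsP[e ue]|] := boolP [exists e, u e - cost M Q e < 0].
    by apply: le_trans (bad _) res0; exists e.
  rewrite negb_exists => /forallP uc.
  have {}uc e : cost M Q e <= u e by have := uc e; rewrite -leNgt subr_ge0.
  case: (ltnP #|M| b) => [Mltb|bM].
    apply: le_trans (le0 _ _ _) res0 => Y.
    have := @potential_ge0 j (#|F| + n.+1) (fun e => u e - cost M Q e).
    have := rm0 M Y; have := ler0n R #|round_matching M Y :&: F|.
    by rewrite /round_value Mltb /=; lra.
  have {bM}Mb : #|M| = b by apply/eqP; rewrite eqn_leq Mb.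
  rewrite /residual; have -> : [forall e in Q, q <= u e].
    apply/forall_inP => e eQ; apply: le_trans (uc e).
    by rewrite /cost eQ mulr1n lerDl completion_prob_ge0.
  set u' := fun e => u e - q *+ (e \in Q).
  have u'01 : prob_fun u'.
    move=> e; have /andP[_ ?] := u01 e; have := uc e; have := completion_prob_ge0 M e.
    have : 0 <= q *+ (e \in Q) by exact: mulrn_wge0.
    by rewrite /u' /cost => *; apply/andP; split; lra.
  have Fi' : increasing (fun H => Fm (M :|: H)).
    by move=> H Y HY; apply: Fi; exact: setUS.
  have cu' e : 0 <= completion_prob M e <= u' e.
    by rewrite completion_prob_ge0 /u' lerBrDl; exact: uc.
  apply: le_trans (expect_union u'01 Fi' cu').
  (* [Y] is the completion sample and [u''] the budget left for the later rounds. *)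
  apply: ler_expect => // Y.
  set u'' := fun e => u' e - completion_prob M e.
  have u''01 : prob_fun u''.
    move=> e; have /andP[? ?] := u'01 e; have /andP[? ?] := cu' e.
    by rewrite /u''; apply/andP; split; lra.
  have pot0 := @potential_ge0 j (#|F| + n.+1) (fun e => u e - cost M Q e).
  have ex0 : 0 <= expect u'' (fun H => Fm (M :|: (Y :|: H))).
    by apply: expect_ge0 => // H.
  rewrite /round_value Mb ltnn /= mulr0n subr0.
  have := rm0 M Y; rewrite /round_misses Mb eqxx mul1r.
  rewrite /misses /round_matching /selected => _.
  case: existsP => /= [ex|_]; last first.
    by have := ler0n R #|(M :|: selected (perm_matching (leftover (m:=m) M)) (normalized k m) Y) :&: F|; rewrite /selected; lra.
  case: pickP => [s /andP[sN sY]|no]; last first.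
    by case: ex => s hs; move: (no s); rewrite hs.
  set X := M :|: _; rewrite subr0.
  have [/eqP XF|XF] := eqVneq #|X :&: F| 0%N; last first.
    have : (1 : R) <= #|X :&: F|%:R by rewrite ler1n lt0n.
    by lra.
  rewrite cards_eq0 in XF; rewrite (eqP XF) cards0 subr0.
  have pX H : perfect_matching (M :|: (Y :|: H)) X by exact: leftover_completion.
  (* [X] is a perfect matching of the union whatever [H] is, so [H] only has to supply the remaining
     [j] matchings. *)
  have : expect u'' (fun H => (packs j (F :|: X) H)%:R) <=
         expect u'' (fun H => Fm (M :|: (Y :|: H))).
    apply: ler_expect => // H; rewrite ler_nat.
    case: (boolP (packs j _ H)) => // h; rewrite (packs_cover (pX H)) //.
      by rewrite -setI_eq0.
    by apply: packs_sub h; rewrite setUA subsetUr.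
  apply: le_trans; apply: le_trans (IH u'' (F :|: X) u''01).
  rewrite lerD2l lerN2.
  have -> : potential j (#|F| + n.+1) (fun e => u e - cost M Q e) =
            potential j (#|F| + n.+1) u''.
    rewrite /potential; congr (_ + _ * _); apply: eq_bigr => e _.
    by rewrite /u'' /u' /cost opprD addrA.
  apply: potential_mono; apply: leq_trans (leq_of_leqif (leq_card_setU _ _)) _.
  rewrite leq_add2l.
  rewrite /X; apply: leq_trans (leq_of_leqif (leq_card_setU _ _)) _.
  rewrite Mb -[leqRHS](subnK mn) leq_add2l.
  by rewrite (leq_trans (leq_imset_card _ _)) // card_ord.
- by split=> [e f|]; rewrite ?inE // cards0.
Qed.

Lemma expect_round_misses M : is_matching M ->
  expect (completion_prob M) (round_misses M) <= 4^-1 ^+ A.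
Proof.
move=> sM; rewrite /round_misses; case: eqP => [Mb|_]; last first.
  rewrite (eq_expect (v := completion_prob M) (G := fun=> 0)) //.
    by rewrite expect_cst exprn_ge0 ?invr_ge0.
  by move=> Y; rewrite mul0r.
have li j := leftover_inj (j := j) sM Mb mn.
rewrite (eq_expect (v := fun e => if [forall j, exists t, leftover (m := m) M j t == e j]
   then q2 else 0) (G := misses (perm_matching (leftover (m := m) M)) (normalized k m))).
- exact: (perm_matching_misses li c0 hc p00 p0c mL q21).
- by move=> e; rewrite /completion_prob Mb eqxx (compatible_leftover _ sM Mb mn).
- by move=> Y; rewrite mul1r.
Qed.

Lemma sum_cost M Q : is_matching M ->
  \sum_e cost M Q e <= q * #|Q|%:R + q2 * (m ^ k.+1)%:R.
Proof.
move=> sM; rewrite big_split /= lerD //.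
  rewrite -sum1_card natr_sum mulr_sumr [leRHS]big_mkcond /=.
  by apply: ler_sum => e _; case: (e \in Q); rewrite ?mulr1.
rewrite /completion_prob; case: eqP => [Mb|_] /=; last first.
  by rewrite big1 ?mulr_ge0.
rewrite -big_mkcond /= sumr_const -[leLHS]mulr_natr ler_wpM2l // ler_nat.
rewrite -cardsE card_compatible // Mb subKn //.
Qed.

Let slope : R := lam * (1 + 2 * (lam * W)).

Let slope0 : 0 <= slope.
Proof. by rewrite mulr_ge0 // addr_ge0 // mulr_ge0. Qed.

(** For fixed [e] the translates of [e] run through all edges, so the sum over [g] factors as
    [load u] times [expR (lam * cost M Q e)]; [expR_le_quadratic] then makes it linear in the
    cost. *)
Lemma load_spent u M Q :
  \sum_(g : E) load (fun e : E => u (translate g e) - cost M Q e) <=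
  load u * ((n.+1 ^ k.+1)%:R + slope * \sum_e cost M Q e).
Proof.
rewrite /load exchange_big /=.
have -> : (n.+1 ^ k.+1)%:R = \sum_(e : E) 1 :> R.
  by rewrite sumr_const card_ffun !card_ord.
rewrite mulr_sumr -big_split mulr_sumr /=; apply: ler_sum => e _.
have -> : \sum_(g : E) expR (- (lam * (u (translate g e) - cost M Q e))) =
          load u * expR (lam * cost M Q e).
  rewrite /load [in RHS](reindex (translate e)) /=; last exact/onW_bij/translate_bij.
  rewrite mulr_suml; apply: eq_bigr => g _.
  by rewrite -expRD translateC; congr expR; ring.
rewrite ler_wpM2l ?load_ge0 //; have /andP[e0 eW] := cost_bounds M Q e.
have lc : lam * cost M Q e <= lam * W by rewrite ler_wpM2l.
have lc0 : 0 <= lam * cost M Q e by rewrite mulr_ge0.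
apply: (le_trans (expR_le_quadratic _)); first by rewrite lc0 (le_trans lc).
have -> : slope * cost M Q e = lam * cost M Q e + 2 * (lam * cost M Q e * (lam * W)).
  by rewrite /slope; ring.
by have := ler_wpM2l lc0 lc; rewrite expr2; lra.
Qed.

Definition average_value j a (l : R) M Q Y : R :=
  1 - (#|M| < b)%N%:R - round_misses M Y - a%:R / (n.+1 ^ k)%:R
  - (j%:R * round_failure + (j * (a + n.+1) + j * j * n.+1)%:R / (n.+1 ^ k)%:R)
  - load_growth ^+ j * (l * (1 + slope / (n.+1 ^ k.+1)%:R * \sum_e cost M Q e)).

(** Averaged over translations, the round matching meets [F] in at most [#|F| / (n.+1) ^ k] edges,
    by [sum_translate_card], and the load term is bounded by [load_spent]. *)
Lemma round_average j u F M Q Y : (#|M| <= b)%N ->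
  (n.+1 ^ k.+1)%:R * average_value j #|F| (load u) M Q Y <=
  \sum_(g : E) round_value j (fun e : E => u (translate g e)) (translate g @^-1: F) M Q Y.
Proof.
move=> Mb; rewrite /round_value /potential.
have cF g : #|translate g @^-1: F| = #|F|.
  by apply: on_card_preimset; exact/onW_bij/translate_bij.
have N0 : (0 : R) < (n.+1 ^ k.+1)%:R by rewrite ltr0n expn_gt0.
have Nk0 : (0 : R) < (n.+1 ^ k)%:R by rewrite ltr0n expn_gt0.
under eq_bigr => g _ do rewrite cF.
set a := (_ < _)%N%:R; set r := round_misses M Y.
set d := _ + _ / _.
have -> : \sum_(g : E) (1 - a - r - #|round_matching M Y :&: translate g @^-1: F|%:R -
      (d + load_growth ^+ j * load (fun e : E => u (translate g e) - cost M Q e))) =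
   (n.+1 ^ k.+1)%:R * (1 - a - r - d)
   - (#|round_matching M Y| * #|F|)%:R
   - load_growth ^+ j * \sum_(g : E) load (fun e : E => u (translate g e) - cost M Q e).
  rewrite -sum_translate_card natr_sum mulr_sumr.
  have -> : (n.+1 ^ k.+1)%:R * (1 - a - r - d) = \sum_(g : E) (1 - a - r - d).
    by rewrite sumr_const card_ffun !card_ord mulr_natl.
  by rewrite -!sumrB; apply: eq_bigr => g _; ring.
have := load_spent u M Q.
move=> /(ler_wpM2l (exprn_ge0 j (le_trans ler01 load_growth_ge1))).
have : ((#|round_matching M Y| * #|F|)%:R : R) <= (n.+1 ^ k.+1)%:R * (#|F|%:R / (n.+1 ^ k)%:R).
  rewrite expnS [(n.+1 * _)%:R]natrM -mulrA [X in _ * X]mulrCA divff ?gt_eqF // mulr1 natrM.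
  by rewrite ler_wpM2r // ler_nat card_round_matching.
rewrite /average_value -/a -/r -/d.
set f := #|F|%:R / _; set cs := \sum_e cost M Q e; set x := load_growth ^+ j.
set y := (#|_| * _)%:R; set z := \sum_(g : E) _; set N := (_ ^ k.+1)%:R.
move=> h1 h2; rewrite !mulrBr.
have -> : N * (x * (load u * (1 + slope / N * cs))) = x * (load u * (N + slope * cs)).
  by field; rewrite gt_eqF.
lra.
Qed.

(** The bound for one round holds for every translation of the data, hence for the average over
    translations, where overlap and cost are small. *)
Lemma packing_induction j : good_packing j.
Proof.
elim: j => [|j IHj] u F u01.
  rewrite /= (eq_expect (v := u) (G := fun=> 1)) // expect_cst.
  by rewrite lerBlDr lerDl potential_ge0.
have N0 : (0 : R) < (n.+1 ^ k.+1)%:R by rewrite ltr0n expn_gt0.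
have t0 := le_trans ler01 load_growth_ge1.
rewrite -(ler_pM2l N0).
have ug01 g : prob_fun (fun e : E => u (translate g e)) by move=> e; exact: u01.
have step g : greedy b q (enum E) set0 set0
    (fun M Q => expect (completion_prob M)
       (round_value j (fun e : E => u (translate g e)) (translate g @^-1: F) M Q))
   <= expect u (fun H => (packs j.+1 F H)%:R).
  apply: (le_trans (round_dominated _ IHj (ug01 g))).
  exact: expect_packs_translate.
have : \sum_(g : E) greedy b q (enum E) set0 set0
    (fun M Q => expect (completion_prob M)
       (round_value j (fun e : E => u (translate g e)) (translate g @^-1: F) M Q))
   <= (n.+1 ^ k.+1)%:R * expect u (fun H => (packs j.+1 F H)%:R).
  apply: (@le_trans _ _ (\sum_(g : E) expect u (fun H => (packs j.+1 F H)%:R))).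
    by apply: ler_sum => g _; exact: step.
  by rewrite sumr_const card_ffun !card_ord mulr_natl.
apply: le_trans; rewrite -greedy_sum.
(* [D] is the price in potential of one unit of total cost. *)
pose D := load_growth ^+ j * load u * (slope / (n.+1 ^ k.+1)%:R).
have D0 : 0 <= D.
  by apply: mulr_ge0; [apply: mulr_ge0; [exact: exprn_ge0|exact: load_ge0]|exact: divr_ge0].
(* All terms that depend on neither [M] nor [Q] go into the opaque constant [C]. *)
have [C CE] : exists C, C = 1 - #|F|%:R / (n.+1 ^ k)%:R
  - (j%:R * round_failure + (j * (#|F| + n.+1) + j * j * n.+1)%:R / (n.+1 ^ k)%:R)
  - load_growth ^+ j * load u - 4^-1 ^+ A - D * (q2 * (m ^ k.+1)%:R) - D * n.+1%:R by eexists.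
(* By [greedy_cost] the expression [#|M| - q * #|Q|] has mean zero, so adding [D] times it trades
   the random number of queries for the bound [#|M| <= n.+1]. *)
apply: (@le_trans _ _ (greedy b q (enum E) set0 set0 (fun M Q =>
   (n.+1 ^ k.+1)%:R * (C + (-1) * (#|M| < b)%N%:R + D * (#|M|%:R - q * #|Q|%:R))))).
  rewrite greedyZ !greedyD !greedyZ greedy_cst greedy_cost ?enum_uniq //; last first.
    by move=> e; rewrite inE.
  rewrite !cards0 mulr0 subrr mulr0 addr0 ler_pM2l // mulN1r.
  have inc := greedy_incomplete k q01 mn.
  apply: (@le_trans _ _ (C - ((2 ^ n.+1) ^ k.+1)%:R * (1 - q) ^+ (m ^ k.+1))); last first.
    by rewrite lerD2l lerN2.
  have tE : load_growth ^+ j.+1 * load u = load_growth ^+ j * load u + D * (q2 * (m ^ k.+1)%:R) + D * n.+1%:R.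
    by rewrite exprS /D /slope {1}/load_growth /mean_cost; field; rewrite gt_eqF.
  have jE : (#|F|%:R + (j * (#|F| + n.+1) + j * j * n.+1)%:R) / (n.+1 ^ k)%:R <=
            (j.+1 * #|F| + j.+1 * j.+1 * n.+1)%:R / (n.+1 ^ k)%:R :> R.
    by rewrite -natrD ler_wpM2r ?invr_ge0 // ler_nat overlap_count.
  rewrite /potential tE CE; move: jE; rewrite mulrDl -natr1 mulrDl mul1r {2}/round_failure.
  lra.
apply: (@greedy_le _ _ _ _ _ q01 (fun M => is_matching M /\ (#|M| <= b)%N))
   => [M e eM Mb [sM _]|M Q [sM Mb]|].
- split; first exact: is_matching_setU1.
  by rewrite cardsU1; case: (_ \notin _) => //; exact: ltnW.
- rewrite -expect_sum.
  have cp01 : prob_fun (completion_prob M).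
    move=> e; rewrite completion_prob_ge0 /= /completion_prob.
    by case: ifP => _; rewrite ?ler01.
  apply: le_trans (ler_expect cp01 (fun Y => round_average j u F Q Y Mb)).
  rewrite expectZ ler_pM2l //.
  have -> : expect (completion_prob M) (average_value j #|F| (load u) M Q) =
     1 - (#|M| < b)%N%:R - #|F|%:R / (n.+1 ^ k)%:R
     - (j%:R * round_failure + (j * (#|F| + n.+1) + j * j * n.+1)%:R / (n.+1 ^ k)%:R)
     - load_growth ^+ j * (load u * (1 + slope / (n.+1 ^ k.+1)%:R * \sum_e cost M Q e))
     + (-1) * expect (completion_prob M) (round_misses M).
    rewrite -expectZ -[X in X + _](expect_cst (completion_prob M)) -expectD.
    by apply: eq_expect => // Y; rewrite /average_value mulN1r; ring.
  have sc := sum_cost Q sM; have em := expect_round_misses sM.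
  have dsc := ler_wpM2l D0 sc.
  have Mn : (#|M|%:R : R) <= n.+1%:R.
    by rewrite ler_nat (leq_trans Mb) // leq_subr.
  have dMn := ler_wpM2l D0 Mn.
  have -> : load_growth ^+ j * (load u * (1 + slope / (n.+1 ^ k.+1)%:R * \sum_e cost M Q e)) =
    load_growth ^+ j * load u + D * \sum_e cost M Q e by rewrite /D; ring.
  rewrite CE; move: dsc; rewrite mulrDr mulrBr => dsc.
  lra.
- by split=> [e f|]; rewrite ?inE // cards0.
Qed.

End Potential.

(** * Choice of the constants *)

Section Estimates.
Variable R : realType.
Implicit Types (x y : R).

(** Raise [x / a <= expR (x / a)] to the power [a]. *)
Lemma expr_le_expR (a : nat) x : 0 <= x -> x ^+ a <= a%:R ^+ a * expR x.
Proof.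
move=> x0; case: a => [|a]; first by rewrite !expr0 mul1r -[leLHS]expR0 ler_expR.
have a0 : (0 : R) < a.+1%:R by rewrite ltr0n.
have -> : expR x = expR (x / a.+1%:R) ^+ a.+1.
  by rewrite -expRM_natr divfK // gt_eqF.
rewrite -exprMn lerXn2r ?nnegrE ?mulr_ge0 ?expR_ge0 //.
rewrite -ler_pdivrMl // mulrC; apply: le_trans (expR_ge1Dx _).
by rewrite lerDr.
Qed.

Lemma expR_half_le2 : expR 2^-1 <= 2 :> R.
Proof.
apply: le_trans (expR_le_quadratic _) _; first by rewrite lexx andbT invr_ge0.
by rewrite le_eqVlt; apply/orP; left; apply/eqP; field.
Qed.

Lemma expR1_le4 : expR 1 <= 4 :> R.
Proof.
have -> : expR 1 = expR 2^-1 ^+ 2 :> R.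
  by rewrite -expRM_natl divff.
have -> : 4 = 2 ^+ 2 :> R by rewrite -natrX.
by rewrite lerXn2r ?nnegrE ?expR_ge0 ?expR_half_le2.
Qed.

(** The falling factorial is at least [(m / e) ^ a]; the inductive step rests on
    [(1 + 1 / m) ^ a <= e] for [a <= m]. *)
Lemma fact_ge_pow (m a : nat) : (a <= m)%N ->
  (m - a)`!%:R * (m%:R / expR 1) ^+ a <= m`!%:R :> R.
Proof.
elim: a m => [|a IHa] m am; first by rewrite subn0 expr0 mulr1.
case: m am => // m; rewrite ltnS => am; rewrite subSS factS natrM.
have e0 : 0 < expR 1 :> R by exact: expR_gt0.
apply: le_trans (_ : m.+1%:R * ((m - a)`!%:R * (m%:R / expR 1) ^+ a) <= _); last first.
  by rewrite ler_pM2l ?ltr0n // IHa.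
rewrite [leRHS]mulrCA ler_wpM2l // exprS -mulrA ler_wpM2l //.
case: (posnP m) => [m0|m0].
  have -> : a = 0%N by apply/eqP; rewrite -leqn0 -m0.
  by rewrite !expr0 mulr1 invf_le1 // -[leLHS]expR0 ler_expR ler01.
have mR : (0 : R) < m%:R by rewrite ltr0n.
have -> : m.+1%:R / expR 1 = m%:R / expR 1 * (1 + m%:R^-1) :> R.
  by rewrite -natr1; field; rewrite !gt_eqF.
rewrite exprMn mulrCA -[leRHS]mulr1 ler_wpM2l ?exprn_ge0 ?divr_ge0 ?(ltW e0) //.
rewrite ler_pdivrMl // mulr1.
apply: (@le_trans _ _ (expR (m%:R^-1) ^+ a)).
  by rewrite lerXn2r ?nnegrE ?addr_ge0 ?invr_ge0 ?expR_ge0 ?expR_ge1Dx.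
rewrite -expRM_natl ler_expR ler_pdivrMr // mul1r ler_nat //.
Qed.

End Estimates.

(** * Parameters and estimates for a fixed number of vertices *)

Section Constants.
Variables (R : realType) (k n : nat) (p s : R).
Local Notation N := (n.+1%:R : R).
Local Notation l := (ln N).

(** Here the uniformity is [k.+1], the parts have size [n.+1], and [s] is the square root of the
    logarithm; this threshold on [s] yields the three inequalities of [slack_ge]. *)
Definition slack_const : R := k.+2%:R * (k.+2%:R + 240 * expR 1 ^+ k).

Hypotheses (k2 : (2 <= k)%N) (s_large : slack_const <= s) (s2 : s ^+ 2 = l).
Hypotheses (lN : l ^+ (40 * k.+1) <= N) (p1 : p <= 1).
Hypotheses (p_ge : l ^+ (4 * k.+1) / N ^+ k <= p).
Hypotheses (p_le : p <= l ^+ (20 * k.+1) / N ^+ k).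

Let ek1 : 1 <= expR 1 ^+ k :> R.
Proof. by rewrite exprn_ege1 // -[leLHS]expR0 ler_expR. Qed.

Let k4 : (4 : R) <= k.+2%:R.
Proof. by rewrite ler_nat. Qed.

Let slack_ge : [/\ k.+2%:R * (k.+2%:R + 120 * expR 1 ^+ k) <= s,
  240 * expR 1 ^+ k <= s & 16 <= s].
Proof.
have h (a b : R) : 4 <= a -> 1 <= b -> a * (a + 240 * b) <= s ->
  [/\ a * (a + 120 * b) <= s, 240 * b <= s & 16 <= s].
  move=> a4 b1 hs.
  have h1 : 0 <= a * (120 * b) by rewrite mulr_ge0 ?mulr_ge0; lra.
  have h2 : 4 * (240 * b) <= a * (240 * b) by rewrite ler_wpM2r ?mulr_ge0; lra.
  have h3 : 4 * a <= a * a by rewrite ler_wpM2r; lra.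
  by move: hs; rewrite !mulrDr => hs; split; nra.
exact: h.
Qed.

Let s16 : 16 <= s. Proof. by case: slack_ge. Qed.
Let s0 : 0 < s. Proof. by apply: lt_le_trans s16. Qed.
Let sl : s <= l.
Proof. by rewrite -s2 expr2 ler_peMl ?(ltW s0) //; apply: le_trans s16; rewrite ler1n. Qed.
Let l16 : 16 <= l. Proof. exact: le_trans sl. Qed.
Let l1 : 1 <= l. Proof. by apply: le_trans l16; rewrite ler1n. Qed.
Let l0 : 0 < l. Proof. exact: lt_le_trans l1. Qed.
Let N0 : 0 < N. Proof. by rewrite ltr0n. Qed.
Let N1 : 1 <= N. Proof. by rewrite ler1n. Qed.

Let lN' (a : nat) : (a <= 40 * k.+1)%N -> l ^+ a <= N.
Proof. by move=> ak; apply: le_trans lN; exact: ler_weXn2l. Qed.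

Definition leftover_size : nat := (Num.trunc (N / l ^+ 3)).+1.
Local Notation m := leftover_size.
Local Notation M := (m%:R : R).

Let m_bounds : N <= M * l ^+ 3 /\ M * l ^+ 3 <= 2 * N.
Proof.
have l3 : 0 < l ^+ 3 by rewrite exprn_gt0.
have x1 : 1 <= N / l ^+ 3.
  by rewrite ler_pdivlMr // mul1r lN' // mulnS.
have x0 : 0 <= N / l ^+ 3 by apply: le_trans x1.
have /andP[h1 h2] := truncn_itv x0.
split; first by rewrite -ler_pdivrMr // ltW.
rewrite -ler_pdivlMr // /m -natr1 -mulrA.
by move: h1 x1; set x := N / _; set t := _%:R; lra.
Qed.

Let M0 : 0 < M. Proof. by rewrite ltr0n. Qed.

Let mN : (m <= n.+1)%N.
Proof.
rewrite -(ler_nat R); have [_ h] := m_bounds.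
have h2 : 2 <= l ^+ 3.
  have h2 : l <= l ^+ 3 by rewrite ler_eXnr.
  by move: l16; lra.
have := ler_wpM2l (ltW M0) h2; lra.
Qed.

(** At least the logarithm of [N], so that [4^-1 ^+ A <= N^-1]. *)
Definition repetitions : nat := (Num.trunc l).+1.
Local Notation A := repetitions.

Let A_bounds : l <= A%:R /\ A%:R <= 2 * l.
Proof.
have /andP[h1 h2] := truncn_itv (ltW l0).
split; first exact: ltW.
by rewrite /A -natr1; move: l1 h1; lra.
Qed.

(** More than twice the logarithm of [N], so that [2 ^ L] exceeds [N] by [expR_half_le2]. *)
Definition halvings : nat := (Num.trunc (2 * l)).+1.
Local Notation L := halvings.

Let L_bounds : 2 * l < L%:R /\ L%:R <= 3 * l.
Proof.
have l20 : 0 <= 2 * l by rewrite mulr_ge0 // ltW.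
have /andP[h1 h2] := truncn_itv l20.
split=> //.
by rewrite /L -natr1; move: l1 h1; lra.
Qed.

Let mL : (m < 2 ^ L)%N.
Proof.
rewrite -(ltr_nat R); apply: (@le_lt_trans _ _ N); first by rewrite ler_nat.
rewrite natrX; apply: (@lt_le_trans _ _ (expR 2^-1 ^+ L)); last first.
  by rewrite lerXn2r ?nnegrE ?expR_ge0 ?expR_half_le2.
rewrite -expRM_natl -[ltLHS]lnK ?posrE // ltr_expR.
by have [h _] := L_bounds; rewrite ltr_pdivlMr // mulrC.
Qed.

(** Chosen so that [q * M ^+ k.+1 = k.+2 * N]: this beats the at most [expR (k.+1 * N)] choices of
    uncovered sets and leaves [expR (- N)]. *)
Definition query_prob : R := k.+2%:R * N / M ^+ k.+1.
Local Notation q := query_prob.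

(** The threshold [20 <= p0 * c ^+ k] holds with equality for [c = M / expR 1]. *)
Definition base_prob : R := 20 / (M / expR 1) ^+ k.
Local Notation p0 := base_prob.

Local Notation q2 := (p0 *+ (L * A)).
Local Notation W := (q + q2).

Let ratio_le (a : nat) : N ^+ a / M ^+ a <= l ^+ (3 * a).
Proof.
rewrite -expr_div_n exprM lerXn2r ?nnegrE ?divr_ge0 ?exprn_ge0 ?(ltW l0) //.
by rewrite ler_pdivrMr // mulrC; case: m_bounds.
Qed.

Let q_bound : q * N ^+ k <= k.+2%:R * l ^+ (3 * k.+1).
Proof.
have -> : q * N ^+ k = k.+2%:R * (N ^+ k.+1 / M ^+ k.+1).
  by rewrite /query_prob [N ^+ _.+1]exprS; ring.
by rewrite ler_wpM2l.
Qed.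

Let p0E : p0 = 20 * expR 1 ^+ k / M ^+ k.
Proof.
rewrite /p0 expr_div_n; field.
by rewrite !expf_neq0 ?gt_eqF ?expR_gt0.
Qed.

Let p00 : 0 < p0.
Proof. by rewrite divr_gt0 // exprn_gt0 // divr_gt0 // expR_gt0. Qed.

Let LA_bound : (L * A)%:R <= 6 * l ^+ 2 :> R.
Proof.
have [_ hA] := A_bounds; have [_ hL] := L_bounds.
rewrite natrM (_ : 6 * l ^+ 2 = 3 * l * (2 * l)); last by ring.
by rewrite ler_pM.
Qed.

Let q2_le : q2 <= 120 * expR 1 ^+ k * l ^+ 2 / M ^+ k.
Proof.
rewrite -[leLHS]mulr_natr; apply: (@le_trans _ _ (p0 * (6 * l ^+ 2))).
  by rewrite ler_pM2l.
by rewrite p0E le_eqVlt; apply/orP; left; apply/eqP; ring.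
Qed.

Let q2_bound : q2 * N ^+ k <= 120 * expR 1 ^+ k * l ^+ (3 * k.+1).
Proof.
apply: le_trans (ler_wpM2r _ q2_le) _; first by rewrite exprn_ge0 // ltW.
have -> : 120 * expR 1 ^+ k * l ^+ 2 / M ^+ k * N ^+ k =
          120 * expR 1 ^+ k * (l ^+ 2 * (N ^+ k / M ^+ k)) by ring.
rewrite ler_wpM2l ?mulr_ge0 ?exprn_ge0 ?expR_ge0 //.
apply: (@le_trans _ _ (l ^+ 2 * l ^+ (3 * k))).
  by rewrite ler_wpM2l // exprn_ge0 // ltW.
by rewrite -exprD ler_weXn2l // mulnS leq_add2r.
Qed.

(** Completion is cheap relative to [N]: its share is of order [l ^+ 2 * M / N], hence [1 / l], and
    [l = s ^+ 2] absorbs the constant. *)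
Let q2_leftover : q2 * M ^+ k.+1 / N <= s^-1.
Proof.
have Nn0 : N != 0 by rewrite gt_eqF.
have Mn0 : M != 0 by rewrite gt_eqF.
have ln0 : l != 0 by rewrite gt_eqF.
have Mk : 0 <= M ^+ k.+1 / N by rewrite divr_ge0 // exprn_ge0.
rewrite -mulrA; apply: le_trans (ler_wpM2r Mk q2_le) _.
have -> : 120 * expR 1 ^+ k * l ^+ 2 / M ^+ k * (M ^+ k.+1 / N) =
          120 * expR 1 ^+ k / l * (M * l ^+ 3 / N).
  rewrite [M ^+ _.+1]exprS; move: Nn0 Mn0 ln0.
  move: l (M) (N) => x y z Nn0 Mn0 ln0.
  by field; rewrite Nn0 ln0 expf_neq0.
apply: (@le_trans _ _ (120 * expR 1 ^+ k / l * 2)).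
  rewrite ler_wpM2l ?divr_ge0 ?mulr_ge0 ?exprn_ge0 ?expR_ge0 ?(ltW l0) //.
  by rewrite ler_pdivrMr //; case: m_bounds.
have -> : 120 * expR 1 ^+ k / l * 2 = 240 * expR 1 ^+ k / l by ring.
have [_ h _] := slack_ge.
rewrite -s2 ler_pdivrMr ?exprn_gt0 // expr2 mulKf ?gt_eqF //.
Qed.

Let q_gt0 : 0 < q.
Proof. by rewrite divr_gt0 ?exprn_gt0 ?mulr_gt0. Qed.

Let q20 : 0 <= q2. Proof. by rewrite mulrn_wge0 // ltW. Qed.

Let W0 : 0 < W. Proof. by rewrite ltr_wpDr. Qed.

Let W_bound : W * N ^+ k <= (k.+2%:R + 120 * expR 1 ^+ k) * l ^+ (3 * k.+1).
Proof. by rewrite [leLHS]mulrDl [leRHS]mulrDl lerD ?q_bound ?q2_bound. Qed.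

Let W1 : W <= 1.
Proof.
have Nk : 0 < N ^+ k by rewrite exprn_gt0.
rewrite -(ler_pM2r Nk) mul1r; apply: le_trans W_bound _.
have [h _ _] := slack_ge.
have C0 : 0 <= k.+2%:R + 120 * expR 1 ^+ k :> R.
  by rewrite addr_ge0 // mulr_ge0 // exprn_ge0 // expR_ge0.
have Cl : k.+2%:R + 120 * expR 1 ^+ k <= l.
  apply: le_trans sl; apply: le_trans h; rewrite ler_peMl //.
  by rewrite ler1n.
apply: (@le_trans _ _ N); last first.
  by rewrite ler_eXnr // (leq_trans _ k2).
apply: (@le_trans _ _ (l * l ^+ (3 * k.+1))).
  by rewrite ler_wpM2r // exprn_ge0 // ltW.
by rewrite -exprS lN' // -addn1 (_ : 40 = 3 + 37)%N // mulnDl leq_add2l muln_gt0.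
Qed.

Local Notation t := (s^-1).
(** Small enough that [lam * W = t] makes the linearisation error negligible, yet large enough for
    [exponent]. *)
Let lam : R := (s * W)^-1.

Let t0 : 0 < t. Proof. by rewrite invr_gt0. Qed.
Let t1 : t <= 2^-1.
Proof. by rewrite lef_pV2 ?posrE //; apply: le_trans s16; rewrite ler_nat. Qed.

Let lamW : lam * W = t.
Proof. by rewrite /lam invfM mulfVK ?gt_eqF. Qed.

Let lam0 : 0 < lam. Proof. by rewrite invr_gt0 mulr_gt0. Qed.

Let round_failure_bound : round_failure k n m A q <= 2 / N.
Proof.
have -> : 2 / N = N^-1 + N^-1 by ring.
rewrite /round_failure lerD //.
  apply: (@le_trans _ _ (expR 1 ^+ (n.+1 * k.+1) * expR (- q) ^+ (m ^ k.+1))).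
    rewrite ler_pM ?exprn_ge0 //.
    - by rewrite subr_ge0; apply: le_trans W1; rewrite lerDl.
    - rewrite -expnM natrX lerXn2r ?nnegrE ?expR_ge0 //.
      by have := expR_ge1Dx (1 : R); apply: le_trans; rewrite -natr1.
    - rewrite lerXn2r ?nnegrE ?expR_ge0 //; last exact: expR_ge1Dx.
      by rewrite subr_ge0; apply: le_trans W1; rewrite lerDl.
  rewrite -!expRM_natl -expRD.
  have -> : (n.+1 * k.+1)%:R * 1 + (m ^ k.+1)%:R * - q = - N.
    have : M ^+ k.+1 != 0 by rewrite expf_neq0 // gt_eqF.
    rewrite natrX natrM /query_prob -[k.+2%:R]natr1.
    by move: (M ^+ _) (k.+1%:R) (N) => x y z x0; field.
  rewrite expRN lef_pV2 ?posrE ?expR_gt0 //.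
  by apply: le_trans (expR_ge1Dx _); rewrite lerDr.
apply: (@le_trans _ _ ((expR 1)^-1 ^+ A)).
  rewrite lerXn2r ?nnegrE ?invr_ge0 ?expR_ge0 //.
  by rewrite lef_pV2 ?posrE ?expR_gt0 ?expR1_le4.
rewrite exprVn -expRM_natl mulr1 lef_pV2 ?posrE ?expR_gt0 //.
by rewrite -[leLHS]lnK ?posrE // ler_expR; case: A_bounds.
Qed.

Let load_growth_bound : load_growth k n m A L q p0 lam <=
  expR (lam * (1 + 2 * t) * (1 + t) / N ^+ k).
Proof.
apply: le_trans (expR_ge1Dx _); rewrite /load_growth lerD2l lamW -!mulrA.
rewrite ler_pM2l // ler_pM2l; last by move: t0; lra.
rewrite natrX exprS invfM !mulrA ler_pM2r ?invr_gt0 ?exprn_gt0 //.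
rewrite ler_pdivrMr // /mean_cost mulrDl mul1r lerD2l.
by rewrite natrX -ler_pdivrMr.
Qed.

Let D : R := N ^+ k * p.

(** Rounding up costs at most [t * D], which leaves a fraction [5 * t] of the budget as a margin. *)
Definition packing_size : nat := (Num.trunc ((1 - 6 * t) * D)).+1.
Local Notation j := packing_size.

Let D_ge : l ^+ (4 * k.+1) <= D.
Proof. by rewrite /D mulrC -ler_pdivrMr ?exprn_gt0. Qed.

Let D_le : D <= l ^+ (20 * k.+1).
Proof. by rewrite /D mulrC -ler_pdivlMr ?exprn_gt0. Qed.

Let lD : l <= D.
Proof. by apply: le_trans D_ge; rewrite ler_eXnr // muln_gt0. Qed.

Let D0 : 0 < D. Proof. exact: lt_le_trans lD. Qed.

Let j_bounds : (1 - 6 * t) * D <= j%:R /\ j%:R <= (1 - 5 * t) * D.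
Proof.
have t16 : t <= 16^-1 by rewrite lef_pV2 ?posrE.
have x0 : 0 <= (1 - 6 * t) * D.
  by rewrite mulr_ge0 ?(ltW D0) //; move: t16; lra.
have /andP[h1 h2] := truncn_itv x0.
split; first exact: ltW.
have tD : 1 <= t * D.
  by rewrite mulrC ler_pdivlMr // mul1r (le_trans sl).
by rewrite /j -natr1; move: h1; set y := _%:R; lra.
Qed.

(** Apart from constants, [W * N ^+ k] is at most [l ^+ (3 * k.+1)], while [D] is at least
    [l ^+ (4 * k.+1)]. Three of the [k.+1] spare factors [l] suffice: for the target, for [s ^+ 2]
    in the denominator and for the constants. This uses [2 <= k]. *)
Let exponent : k.+2%:R * l <= lam * (p * t).
Proof.
have Nk : 0 < N ^+ k by rewrite exprn_gt0.
have -> : lam * (p * t) = D / (l * (W * N ^+ k)).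
  have sn0 : s != 0 by rewrite gt_eqF.
  have Wn0 : W != 0 by rewrite gt_eqF.
  have Nn0 : N ^+ k != 0 by rewrite gt_eqF.
  rewrite /lam /D -s2; move: sn0 Wn0 Nn0; move: (W) (N ^+ k) => x y sn0 x0 y0.
  by field; rewrite sn0 x0 y0.
rewrite ler_pdivlMr ?mulr_gt0 //.
apply: le_trans D_ge.
apply: (@le_trans _ _ (k.+2%:R * l * (l * ((k.+2%:R + 120 * expR 1 ^+ k) * l ^+ (3 * k.+1))))).
  by rewrite ler_wpM2l ?mulr_ge0 ?(ltW l0) // ler_wpM2l ?(ltW l0).
have [h _ _] := slack_ge.
apply: (@le_trans _ _ (l * l * (l * l ^+ (3 * k.+1)))).
  have -> : k.+2%:R * l * (l * ((k.+2%:R + 120 * expR 1 ^+ k) * l ^+ (3 * k.+1))) =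
    l * l * ((k.+2%:R * (k.+2%:R + 120 * expR 1 ^+ k)) * l ^+ (3 * k.+1)) by ring.
  rewrite ler_wpM2l ?mulr_ge0 ?(ltW l0) // ler_wpM2r ?exprn_ge0 ?(ltW l0) //.
  exact: le_trans sl.
rewrite -mulrA -!exprS ler_weXn2l //.
by rewrite (_ : 4 = 1 + 3)%N // mulnDl mul1n -[(3 * _).+3]add3n leq_add2r.
Qed.

(** The initial load is [N ^+ k.+1 * expR (- (lam * p))]. As [(1 + 2 * t) * (1 + t) * (1 - 5 * t) <=
    1 - t], the [j] rounds multiply it by at most [expR (lam * (p * (1 - t)))], and [exponent]
    bounds what remains. *)
Let load_bound : load_growth k n m A L q p0 lam ^+ j * load (k := k) (n := n) lam (fun=> p) <= N^-1.
Proof.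
have -> : load (k := k) (n := n) lam (fun=> p) = N ^+ k.+1 * expR (- (lam * p)).
  by rewrite /load sumr_const card_ffun !card_ord -natrX mulr_natl.
have p0' : 0 < p by move: D0; rewrite /D pmulr_rgt0 // exprn_gt0.
have th0 : 0 <= load_growth k n m A L q p0 lam.
  rewrite /load_growth addr_ge0 // divr_ge0 // mulr_ge0 //.
    by rewrite mulr_ge0 ?(ltW lam0) // lamW; move: t0; lra.
  by rewrite /mean_cost addr_ge0 // mulr_ge0.
apply: (@le_trans _ _ (expR (lam * (p * (1 - t))) * (N ^+ k.+1 * expR (- (lam * p))))).
  rewrite ler_wpM2r ?mulr_ge0 ?exprn_ge0 ?expR_ge0 //.
  apply: le_trans (lerXn2r j th0 (expR_ge0 _) load_growth_bound) _.
  rewrite -expRM_natl ler_expR.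
  have -> : j%:R * (lam * (1 + 2 * t) * (1 + t) / N ^+ k) =
            lam * ((1 + 2 * t) * (1 + t)) * (j%:R / N ^+ k) by ring.
  have jp : j%:R / N ^+ k <= (1 - 5 * t) * p.
    rewrite ler_pdivrMr ?exprn_gt0 //; have [_ h] := j_bounds.
    by apply: (le_trans h); rewrite -mulrA [p * _]mulrC.
  have t2 : 0 <= 1 + 2 * t by move: t0; lra.
  have t3 : 0 <= 1 + t by move: t0; lra.
  apply: (@le_trans _ _ (lam * ((1 + 2 * t) * (1 + t)) * ((1 - 5 * t) * p))).
    by rewrite ler_wpM2l // !mulr_ge0 ?(ltW lam0).
  rewrite -mulrA ler_pM2l // mulrA [leRHS]mulrC ler_pM2r //.
  have t30 : 0 <= t ^+ 2 * (1 + t) by rewrite mulr_ge0 ?sqr_ge0.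
  have t20 := sqr_ge0 t.
  have -> : (1 + 2 * t) * (1 + t) * (1 - 5 * t) =
     1 - t - t - 3 * t ^+ 2 - 10 * (t ^+ 2 * (1 + t)) by ring.
  by move: t0; lra.
rewrite mulrCA -expRD.
have -> : lam * (p * (1 - t)) + - (lam * p) = - (lam * (p * t)) by ring.
apply: (@le_trans _ _ (N ^+ k.+1 * expR (- (k.+2%:R * l)))).
  by rewrite ler_wpM2l ?exprn_ge0 // ler_expR lerN2.
rewrite expRN expRM_natl lnK ?posrE // [N ^+ k.+2]exprSr invfM mulrA.
by rewrite divff ?mul1r // expf_neq0 // gt_eqF.
Qed.

Lemma packing_estimate : (1 - 6 * t) * N ^+ k * p <= j%:R /\
  1 - 4 * l ^+ (40 * k.+1) / N <=
  expect (fun=> p) (fun H : {set edge k.+1 n.+1} => (packs j set0 H)%:R).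
Proof.
split; first by rewrite -mulrA; case: j_bounds.
have p0' : 0 < p by move: D0; rewrite /D pmulr_rgt0 // exprn_gt0.
have p01 : prob_fun (fun _ : edge k.+1 n.+1 => p) by move=> e; rewrite ltW.
have hc a : (a <= m)%N -> (m - a)`!%:R * (M / expR 1) ^+ a <= m`!%:R.
  exact: fact_ge_pow.
have e0 : 0 < M / expR 1 by rewrite divr_gt0 // expR_gt0.
have q01 : 0 <= q <= 1 by rewrite ltW //=; apply: le_trans W1; rewrite lerDl.
have q21 : q2 <= 1 by apply: le_trans W1; rewrite lerDr ltW.
have p0c : 20 <= p0 * (M / expR 1) ^+ k.
  by rewrite /base_prob divfK // expf_neq0 // gt_eqF.
have lamW2 : lam * W <= 2^-1 by rewrite lamW.
have := packing_induction mN q01 e0 hc p00 p0c mL q21 (ltW lam0) lamW2 j set0 p01.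
apply: le_trans; rewrite lerD2l lerN2 /potential cards0 muln0 add0n.
set X := l ^+ (20 * k.+1).
have X1 : 1 <= X by rewrite exprn_ege1.
have XX : l ^+ (40 * k.+1) = X * X by rewrite /X -exprD -mulnDl.
have jX : j%:R <= X.
  have [_ h] := j_bounds; apply: (le_trans h); apply: le_trans D_le.
  by rewrite ler_piMl ?(ltW D0) //; move: t0; lra.
have h1 : j%:R * round_failure k n m A q <= X * (2 / N).
  apply: (@le_trans _ _ (j%:R * (2 / N))); first by rewrite ler_wpM2l.
  by rewrite ler_wpM2r // divr_ge0.
(* The overlap term is small because [2 <= k] gives [N / N ^+ k <= N^-1]. *)
have h2 : (j * j * n.+1)%:R / (n.+1 ^ k)%:R <= X * X / N.
  rewrite !natrM natrX -mulrA ler_pM ?mulr_ge0 ?invr_ge0 ?exprn_ge0 //.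
    by rewrite ler_pM.
  rewrite ler_pdivrMr ?exprn_gt0 // mulrC ler_pdivlMr // -expr2.
  exact: ler_weXn2l.
apply: le_trans (lerD (lerD h1 h2) load_bound) _.
rewrite XX (_ : X * (2 / N) + X * X / N + N^-1 = (2 * X + X * X + 1) / N); last by ring.
rewrite ler_pM2r ?invr_gt0 //.
by have := ler_wpM2l (le_trans ler01 X1) X1; rewrite mulr1; lra.
Qed.

End Constants.

(** * Transfer to the random hypergraph and the limit *)

Lemma hypergraph_prob_expect (R : realType) (k n : nat) (p : R)
    (P : pred (hypergraph k n)) :
  hypergraph_prob k n p P = expect (fun=> p) (fun H => (P H)%:R).
Proof.
rewrite /hypergraph_prob big_mkcond; apply: eq_bigr => H _.
by rewrite /hypergraph_mass /mass; case: (P H); rewrite ?mulr1 ?mulr0.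
Qed.

Lemma packing_probability (R : realType) (k n : nat) (p : R) :
  (2 <= k)%N -> (0 < n)%N -> slack_const R k <= Num.sqrt (ln n%:R) ->
  ln n%:R ^+ (40 * k.+1) <= n%:R :> R -> 0 < ln n%:R :> R -> 0 <= p <= 1 ->
  ln n%:R ^+ (4 * k.+1) / n%:R ^+ k <= p <= ln n%:R ^+ (20 * k.+1) / n%:R ^+ k ->
  1 - 4 * ln n%:R ^+ (40 * k.+1) / n%:R <=
    hypergraph_prob k.+1 n p (fun H : hypergraph k.+1 n =>
      [exists F : {set {set edge k.+1 n}},
        edge_disjoint_perfect_matchings H F &&
        ((1 - 6 * (Num.sqrt (ln n%:R))^-1) * n%:R ^+ k * p <= #|F|%:R)]).
Proof.
case: n => // n k2 _ sn lN ln0 /andP[p0 p1] /andP[pge ple].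
have s2 : Num.sqrt (ln n.+1%:R) ^+ 2 = ln n.+1%:R :> R by rewrite sqr_sqrtr // ltW.
have [jlarge est] := packing_estimate k2 sn s2 lN p1 pge ple.
rewrite hypergraph_prob_expect; apply: (le_trans est).
apply: ler_expect => [e|H]; first by rewrite p0.
rewrite ler_nat; case: (boolP (packs _ _ _)) => // /packs_family[F [Fj Fd _]].
rewrite lt0b; apply/existsP; exists F; rewrite Fd Fj /=.
exact: jlarge.
Qed.

Local Open Scope classical_set_scope.

Lemma cvg_ln_nat (R : realType) : (fun n : nat => ln (n%:R : R)) @ \oo --> +oo.
Proof.
apply/cvgryPge => B; near=> n.
have Bn : expR B <= n%:R by near: n; exact: nbhs_infty_ger.
by rewrite -[B]expRK ler_ln ?posrE ?expR_gt0 // (lt_le_trans _ Bn) ?expR_gt0.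
Unshelve. all: by end_near.
Qed.

Theorem theorem6 (R : realType) (k : nat) (hk : (3 <= k)%N) (p : nat -> R)
  (hp01 : forall n : nat, 0 <= p n <= 1)
  (hp : \forall n \near \oo,
     ln n%:R ^+ (4 * k) / n%:R ^+ (k - 1) <= p n
       <= ln n%:R ^+ (20 * k) / n%:R ^+ (k - 1)) :
  exists eps : nat -> R,
    eps @ \oo --> (0 : R) /\
    (fun n : nat =>
       hypergraph_prob k n (p n) (fun H : hypergraph k n =>
         [exists F : {set {set edge k n}},
            edge_disjoint_perfect_matchings H F &&
            ((1 - eps n) * n%:R ^+ (k - 1) * p n <= #|F|%:R)]))
      @ \oo --> (1 : R).
Proof.
case: k hk hp => // k k2 hp; rewrite subn1 /= in hp *.
pose l (n : nat) : R := ln n%:R.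
have cl : l @ \oo --> +oo by exact: cvg_ln_nat.
have l_ge (B : R) : \forall n \near \oo, B <= l n by move/cvgryPge: cl; exact.
have l_gt0 : \forall n \near \oo, 0 < l n.
  by near=> n; apply: (@lt_le_trans _ _ 1) => //; near: n; exact: l_ge.
have sqrt_ge (B : R) : \forall n \near \oo, B <= Num.sqrt (l n).
  near=> n; have B2 : `|B| ^+ 2 <= l n by near: n; exact: l_ge.
  apply: (le_trans (ler_norm B)); rewrite -(ger0_norm (normr_ge0 B)) -sqrtr_sqr.
  by rewrite ler_wsqrtr.
(* With one extra power, [l n ^+ a.+1 <= C * n] by [expr_le_expR]; hence [l n ^+ a / n <= C / l n],
   so the failure bound tends to 0. *)
pose a := (40 * k.+1)%N; pose C : R := a.+1%:R ^+ a.+1.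
exists (fun n => 6 * (Num.sqrt (l n))^-1); split.
  rewrite -[X in _ --> X](mulr0 6); apply: cvgMr.
  apply/gtr0_cvgV0.
    by near=> n; rewrite sqrtr_gt0; near: n.
  by apply/cvgryPge => B; exact: sqrt_ge.
apply: (@squeeze_cvgr _ _ _ _ (fun n => 1 - 4 * C * (l n)^-1) (fun=> 1)); last 2 first.
- rewrite -[X in _ --> X]subr0 -[X in _ --> _ - X](mulr0 (4 * C)).
  apply: cvgB; first exact: cvg_cst.
  by apply: cvgMr; apply/gtr0_cvgV0.
- exact: cvg_cst.
near=> n.
have n0 : (0 < n)%N by near: n; exact: nbhs_infty_gt.
have lC : C <= l n by near: n; exact: l_ge.
have ln0 : 0 < l n by near: n.
have sn : slack_const R k <= Num.sqrt (l n) by near: n; exact: sqrt_ge.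
have /andP[pge ple] : l n ^+ (4 * k.+1) / n%:R ^+ k <= p n <= l n ^+ (20 * k.+1) / n%:R ^+ k.
  by near: n.
have /andP[pn0 pn1] := hp01 n.
have C0 : 0 < C by rewrite exprn_gt0 // ltr0n.
have lan : l n ^+ a.+1 <= C * n%:R.
  have := expr_le_expR a.+1 (ltW ln0); rewrite -/C.
  by rewrite {2}/l lnK ?posrE ?ltr0n.
have nR : (0 : R) < n%:R by rewrite ltr0n.
have lN : l n ^+ a <= n%:R.
  rewrite -(ler_pM2l C0); apply: le_trans lan.
  by rewrite exprS ler_wpM2r // exprn_ge0 // ltW.
have lnl : l n ^+ a / n%:R <= C * (l n)^-1.
  by rewrite ler_pdivrMr // mulrAC ler_pdivlMr // -exprSr.
apply/andP; split; last first.
  rewrite hypergraph_prob_expect -[leRHS](expect_cst (fun _ : edge k.+1 n => p n)).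
  by apply: ler_expect => [e|H]; [exact: hp01 | rewrite lern1 leq_b1].
apply: le_trans (packing_probability k2 n0 sn lN ln0 (hp01 n) _); last first.
  by rewrite pge ple.
by rewrite lerD2l lerN2 -[leLHS]mulrA -[leRHS]mulrA ler_pM2l ?lnl.
Unshelve. all: by end_near.
Qed.
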